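(* Let $\mathbb F$ be a finite field and $n$ a divisor of $|\mathbb F|-1$. Let $s=\varepsilon n\log|\mathbb F|$ for a sufficiently small constant $\varepsilon>0$. Assuming the Weaker Network Coding Conjecture (stated in the context), $t^{\mathbb F}_\mathsf{Eval}(s)\ge \Omega\bigl(\log n/\log\log n\bigr)$ and $t^{\mathbb F}_\mathsf{Interp}(s)\ge \Omega\bigl(\log n/\log\log n\bigr)$.
   Context: Let $[n]=\{0,\dots,n-1\}$. A (non-uniform) systematic data structure for a problem with input $I=(x_0,\dots,x_{n-1})$ is a pair of algorithms: a preprocessing algorithm producing from $I$ an advice string $a\in\{0,1\}^s$ ($s$ is the space), and a query algorithm that, on a query, has full access to $a$ and may read at most $t$ entries $x_i$ of $I$ ($t$ is the query time), and must output the correct answer. It is non-adaptive if the set of input entries read on a query depends only on the query. Polynomial evaluation over $\mathbb F$: the input is the coefficients $\alpha_0,\dots,\alpha_{n-1}\in\mathbb F$ of $p(x)=\sum_{i\in[n]}\alpha_ix^i$; a query is $x\in\mathbb F$ and the answer is $p(x)$. Polynomial interpolation over $\mathbb F$: the input is point–value pairs $(x_0,p(x_0)),\dots,(x_{n-1},p(x_{n-1}))\in\mathbb F\times\mathbb F$ of a polynomial $p$ of degree at most $n-1$ with pairwise distinct $x_i$; a query is an index $j\in[n]$ and the answer is the coefficient of $x^j$ in $p$. $t^{\mathbb F}_\mathsf{Eval}(s)$ (resp. $t^{\mathbb F}_\mathsf{Interp}(s)$) is the query time of an optimal non-adaptive systematic data structure for polynomial evaluation (resp. interpolation) over $\mathbb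 F$ with degree bound $n-1$ using space at most $s$. Networks: a network $R=(G,c,(s_i,t_i)_{i\in[k]})$ consists of a graph $G=(V,E)$, capacities $c:E\to\mathbb R^+$ and $k$ source–target pairs. For a directed acyclic network (each $s_i$ of in-degree $0$), each source $s_i$ receives a message $w_i$ drawn independently and uniformly from a set $W_i$; a coding scheme specifies, for each edge $e$ an alphabet $\Sigma_e$, for each edge out of $s_i$ a function of $w_i$, for each edge out of a non-source vertex $v$ a function of the messages on edges into $v$, and for each target $t_i$ a decoding function of the messages into $t_i$; it is correct if every $t_i$ outputs $w_i$ for all inputs; it must satisfy $H(\mathbf M_e)\le c(e)$ where $\mathbf M_e$ is the random message on $e$ and $H$ is Shannon entropy. The coding rate of $R$ is the maximum $r$ such that there is a correct coding scheme with $\log|W_i|\ge r$ for all $i$. For an undirected network, a multicommodity flow consists of flows $f^i:V\times V\to\mathbb R_{\ge0}$ of commodity $i$ from $s_i$ to $t_i$ (supported on edges, at most one direction per edge, conserved at vertices other than $s_i,t_i$) with $\sum_i (f^i(u,v)+f^i(v,u))\le c(\{u,v\})$ for every edge; the flow rate is the maximum $r$ such that some multicommodity flow delivers at least $r$ units of each commodity $i$ to $t_i$. For directed $G$, $\mathsf{un}(G)$ forgets directions, and $\mathsf{un}(R)$ is the undirected network on $\mathsf{un}(G)$ with the same capacities and source–target pairs. Weaker Network Coding Conjecture: for every directed acyclic network $R$, the coding rate of $R$ equals the flow rate of $\mathsf{un}(R)$. *)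

(* Defs.v *)
From HB Require Import structures.
From mathcomp Require Import all_boot all_order all_algebra.
From mathcomp Require Import all_classical all_reals all_analysis.

Set Implicit Arguments.
Unset Strict Implicit.
Unset Printing Implicit Defensive.

Import Order.TTheory GRing.Theory Num.Theory.

Local Open Scope classical_set_scope.
Local Open Scope ring_scope.

Definition log2 (R : realType) (x : R) : R := ln x / ln 2%:R.

(** * Non-adaptive systematic data structures *)

(* A problem is a relation [spec I q a]: "[I] is a legal input and [a] is the
   answer to query [q] on [I]"; nothing is required on illegal inputs.
   The query algorithm receives the query, the whole advice string and the
   entries at the positions in [probe q], which depends on the query only. *)
Record nonadaptive_ds (n : nat) (X Q A : Type)
    (spec : ('I_n -> X) -> Q -> A -> Prop) (s t : nat) := NonadaptiveDS {
  advice : ('I_n -> X) -> s.-tuple bool;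
  probe : Q -> {set 'I_n};
  answer : forall q : Q, s.-tuple bool -> (forall i, i \in probe q -> X) -> A;
  probe_le : forall q, (#|probe q| <= t)%N;
  answer_correct : forall (I : 'I_n -> X) (q : Q) (a : A),
    spec I q a -> answer (advice I) (fun i (_ : i \in probe q) => I i) = a
}.

(* Values in [\bar R] only to make the minimum total: the set is nonempty as
   soon as [0 <= s] (read the whole input), and it consists of naturals, so the
   infimum is attained. *)
Definition opt_time (R : realType) (n : nat) (X Q A : Type)
    (spec : ('I_n -> X) -> Q -> A -> Prop) (s : R) : \bar R :=
  ereal_inf [set t%:R%:E | t in
    [set t : nat | exists2 s' : nat, s'%:R <= s &
                   inhabited (nonadaptive_ds spec s' t)]].

Definition eval_spec (F : fieldType) (n : nat)
    (alpha : 'I_n -> F) (x : F) (a : F) : Prop :=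
  a = (\sum_(i < n) alpha i *: 'X^i).[x].

(* An entry of the input is a pair (x_i, p(x_i)), read by a single probe. *)
Definition interp_spec (F : fieldType) (n : nat)
    (I : 'I_n -> F * F) (j : 'I_n) (a : F) : Prop :=
  injective (fun i => (I i).1) /\
  exists p : {poly F}, [/\ (size p <= n)%N,
    forall i, (I i).2 = p.[(I i).1] & a = p`_j].

Definition t_Eval (R : realType) (F : finFieldType) (n : nat) (s : R) :=
  opt_time (@eval_spec F n) s.

Definition t_Interp (R : realType) (F : finFieldType) (n : nat) (s : R) :=
  opt_time (@interp_spec F n) s.

(** * Networks *)

Record dag_network (R : realType) := DagNetwork {
  dvert : finType;
  dedge : rel dvert;
  dcap : dvert -> dvert -> R;   (* only meaningful on edges *)
  dpairs : nat;
  dsrc : 'I_dpairs -> dvert;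
  dtgt : 'I_dpairs -> dvert;
  dcap_gt0 : forall u v, dedge u v -> 0 < dcap u v;
  dacyclic : forall u (p : seq dvert), p != [::] -> path dedge u p -> last u p != u;
  dsrc_in0 : forall i u, ~~ dedge u (dsrc i)
}.

Record undir_network (R : realType) := UndirNetwork {
  uvert : finType;
  uedge : rel uvert;
  ucap : uvert -> uvert -> R;
  upairs : nat;
  usrc : 'I_upairs -> uvert;
  utgt : 'I_upairs -> uvert;
  uedge_sym : symmetric uedge;
  uedge_irr : irreflexive uedge;
  ucap_sym : forall u v, uedge u v -> ucap u v = ucap v u;
  ucap_gt0 : forall u v, uedge u v -> 0 < ucap u v
}.

Section Undirect.
Variables (R : realType) (N : dag_network R).

Local Notation E := (@dedge R N).

Definition un_edge : rel (dvert N) := fun u v => E u v || E v u.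

Definition un_cap (u v : dvert N) : R := if E u v then dcap u v else dcap v u.

Lemma dedge_irr u : E u u = false.
Proof.
apply/negP => Euu; have /= := @dacyclic _ N u [:: u] isT.
by rewrite Euu eqxx => /(_ isT).
Qed.

Lemma dedge_asym u v : E u v -> E v u = false.
Proof.
move=> Euv; apply/negP => Evu; have /= := @dacyclic _ N u [:: v; u] isT.
by rewrite Euv Evu eqxx => /(_ isT).
Qed.

Lemma un_edge_sym : symmetric un_edge.
Proof. by move=> u v; rewrite /un_edge orbC. Qed.

Lemma un_edge_irr : irreflexive un_edge.
Proof. by move=> u; rewrite /un_edge dedge_irr. Qed.

Lemma un_cap_sym u v : un_edge u v -> un_cap u v = un_cap v u.
Proof. by rewrite /un_cap => /orP[] Euv; rewrite Euv (dedge_asym Euv). Qed.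

Lemma un_cap_gt0 u v : un_edge u v -> 0 < un_cap u v.
Proof.
rewrite /un_cap; case: ifP => [Euv _|Euv]; first exact: dcap_gt0.
by rewrite /un_edge Euv => /dcap_gt0.
Qed.

Definition un : undir_network R :=
  UndirNetwork (@dsrc _ N) (@dtgt _ N)
    un_edge_sym un_edge_irr un_cap_sym un_cap_gt0.

End Undirect.

(** * Coding rate of a directed acyclic network *)

(* Shannon entropy, in bits, of [X w] for [w] uniform on [T]. *)
Definition unif_prob (R : realType) (T S : finType) (X : T -> S) (y : S) : R :=
  #|[set w : T | X w == y]%SET|%:R / #|T|%:R.

Definition unif_entropy (R : realType) (T S : finType) (X : T -> S) : R :=
  - \sum_(y : S) unif_prob R X y * log2 (unif_prob R X y).

(* The encoder of an edge (u, v) sees the messages of the sources located at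
   [u] and the messages on the edges into [u]. Since sources have in-degree 0,
   the second argument is empty if [u] is a source and the first one is empty if
   it is not. *)
Record coding_scheme (R : realType) (N : dag_network R) := CodingScheme {
  word : 'I_(dpairs N) -> finType;
  word_gt0 : forall i, (0 < #|word i|)%N;
  alphabet : forall u v : dvert N, dedge u v -> finType;
  edge_encoder : forall (u v : dvert N) (e : dedge u v),
    (forall i, dsrc i = u -> word i) ->
    (forall x (e' : dedge x u), alphabet e') -> alphabet e;
  tgt_decoder : forall i : 'I_(dpairs N),
    (forall x (e' : dedge x (dtgt i)), alphabet e') -> word i
}.

Section Coding.
Variables (R : realType) (N : dag_network R) (C : coding_scheme N).

(* Independent uniform source messages = a uniform element of the product. *)
Definition inputs : finType := {dffun forall i : 'I_(dpairs N), word C i}.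

Definition edge_messages :=
  forall (u v : dvert N) (e : dedge u v), inputs -> alphabet C e.

(* By acyclicity this determines [M]. *)
Definition transmits (M : edge_messages) : Prop :=
  forall (u v : dvert N) (e : dedge u v) (w : inputs),
    M u v e w = edge_encoder e (fun i _ => w i) (fun x e' => M x u e' w).

Definition correct_scheme (M : edge_messages) : Prop :=
  forall (w : inputs) i, tgt_decoder (fun x e' => M x (dtgt i) e' w) = w i.

Definition within_capacity (M : edge_messages) : Prop :=
  forall (u v : dvert N) (e : dedge u v),
    unif_entropy R (M u v e) <= dcap u v.

End Coding.

Definition coding_achieves (R : realType) (N : dag_network R) (r : R) : Prop :=
  exists (C : coding_scheme N) (M : edge_messages C),
    [/\ transmits M, correct_scheme M, within_capacity M &
        forall i, r <= log2 #|word C i|%:R].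

(* In [\bar R] so as to be total; for [0 < dpairs N] it is a real maximum. *)
Definition coding_rate (R : realType) (N : dag_network R) : \bar R :=
  ereal_sup [set r%:E | r in [set r : R | coding_achieves N r]].

(** * Flow rate of an undirected network *)

Definition multiflow (R : realType) (N : undir_network R)
    (f : 'I_(upairs N) -> uvert N -> uvert N -> R) : Prop :=
  [/\ forall i u v, 0 <= f i u v,
      forall i u v, ~~ uedge u v -> f i u v = 0,
      forall i u v, f i u v = 0 \/ f i v u = 0,
      forall i v, v != usrc i -> v != utgt i ->
        \sum_u f i u v = \sum_u f i v u &
      forall u v, uedge u v -> \sum_i (f i u v + f i v u) <= ucap u v].

Definition flow_achieves (R : realType) (N : undir_network R) (r : R) : Prop :=
  exists2 f : 'I_(upairs N) -> uvert N -> uvert N -> R, multiflow f &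
    forall i, r <= \sum_u (f i u (utgt i) - f i (utgt i) u).

Definition flow_rate (R : realType) (N : undir_network R) : \bar R :=
  ereal_sup [set r%:E | r in [set r : R | flow_achieves N r]].

(* The conjecture is usually phrased as an equality of the two rates. The
   inequality below is its content: literal equality fails for the network
   s -> w <- t, where no information goes from s to t although un(N) carries a
   flow, and for one edge of capacity 1/2 (message sets are discrete). *)
Definition weaker_NCC (R : realType) : Prop :=
  forall N : dag_network R, (coding_rate N <= flow_rate (un N))%E.

Lemma weaker_NCC_of_eq (R : realType) :
  (forall N : dag_network R, coding_rate N = flow_rate (un N)) -> weaker_NCC R.
Proof. by move=> eqN N; rewrite eqN. Qed.

(* Main.v *)
Require Import Defs.
From HB Require Import structures.
From mathcomp Require Import all_boot all_order all_algebra.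
From mathcomp Require Import all_classical all_reals all_analysis.
From mathcomp Require Import ring lra zify.
From mathcomp Require cyclic finfield.

Set Implicit Arguments.
Unset Strict Implicit.
Unset Printing Implicit Defensive.

Import Order.TTheory GRing.Theory Num.Theory.

Local Open Scope ring_scope.

(** Let [om] be a primitive [n]-th root of unity and [Phi] the discrete Fourier
transform. Both problems provide a structure for [Phi] (interpolation at the
powers of [om^-1] is [Phi] up to the factor [n]), and applying it twice, with a
multiplication by [om^(d j)] in between, brings input [v_i] to output
[rho d i = - (i + d)]. So a structure with few probes is a shallow layered
network of small degree that routes every [v_i] to a target of our choice, once
the advice and the values at the few positions read by many queries are fixed.
Fixing them confines the input to a set [X] of size [q^(n (1 - delta))].

The words [w] of a network code are independent and uniform. A supervisor that
sees all of [w] picks [x] in [X] and sends the coordinates of [x - w] to the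
[i]-th input and the [i]-th target. A covering argument chooses [x] such that
most of these coordinates lie in small sets fixed in advance, so that the
corrections have small total entropy.

In the undirected network the supervisor carries little more than half of the
required flow, since everything that enters it by a source edge of capacity
[log q] must leave by another. The rest follows paths of length at least [l]
for a shift [d] that puts most targets far from their sources, which takes
total capacity [n l log q / 16]; as only [O(n t log q)] is available,
[l = O(t)]. Targets can be put at distance [l] as long as [O(t)^l <= n / 4]. *)

(** * Binary logarithm and covering *)

Section Log2.
Variable R : realType.
Implicit Types x y : R.

Lemma ln2_gt0 : 0 < ln 2%:R :> R.
Proof. by rewrite ln_gt0 // ltr1n. Qed.

Lemma log2M x y : 0 < x -> 0 < y -> log2 (x * y) = log2 x + log2 y.
Proof. by move=> x0 y0; rewrite /log2 lnM ?posrE // mulrDl. Qed.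

Lemma log2V x : 0 < x -> log2 x^-1 = - log2 x.
Proof. by move=> x0; rewrite /log2 lnV ?posrE // mulNr. Qed.

Lemma log21 : log2 (1 : R) = 0.
Proof. by rewrite /log2 ln1 mul0r. Qed.

Lemma log2X x n : 0 < x -> log2 (x ^+ n) = n%:R * log2 x.
Proof. by move=> x0; rewrite mulr_natl /log2 lnXn // mulrnAl. Qed.

Lemma log2_2 : log2 (2%:R : R) = 1.
Proof. by rewrite /log2 divff // gt_eqF // ln2_gt0. Qed.

Lemma ler_log2 x y : 0 < x -> x <= y -> log2 x <= log2 y.
Proof.
move=> x0 xy; rewrite /log2 ler_pM2r ?invr_gt0 ?ln2_gt0 //.
by rewrite ler_ln ?posrE // (lt_le_trans x0).
Qed.

Lemma log2_ge0 x : 1 <= x -> 0 <= log2 x.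
Proof. by move=> x1; rewrite -log21 ler_log2. Qed.

End Log2.

Section Covering.
Variables (R : realType) (F : finZmodType) (k e : nat) (eta : R).
Local Notation pool := {ffun 'I_k -> F}.
Local Notation q := #|F|.
Hypothesis e_gt0 : (0 < e)%N.

Lemma sum_tuple_cons (A : finType) n (f : n.+1.-tuple A -> R) :
  \sum_t f t = \sum_a \sum_(t : n.-tuple A) f [tuple of a :: t].
Proof.
rewrite pair_big /= (reindex (fun p : A * n.-tuple A => [tuple of p.1 :: p.2])) //=.
apply: onW_bij; exists (fun t => (thead t, [tuple of behead t])) => [[a t]|t].
  by rewrite theadE; congr (_, _); apply: val_inj.
by rewrite /= [RHS]tuple_eta.
Qed.

(** A pool lists the corrections that are cheap to send. The indicator is real-valued because it is
    averaged over words and pools. *)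
Definition miss (b : pool) (z : F) : R := (z \notin codom b)%:R.

Definition misses n (B : n.-tuple pool) (w x : n.-tuple F) : R :=
  \sum_(i < n) miss (tnth B i) (tnth x i - tnth w i).

Lemma misses_cons n b (B : n.-tuple pool) w (ws : n.-tuple F) x (xs : n.-tuple F) :
  misses [tuple of b :: B] [tuple of w :: ws] [tuple of x :: xs]
  = miss b (x - w) + misses B ws xs.
Proof.
rewrite /misses big_ord_recl !tnth0; congr (_ + _).
by apply: eq_bigr => i _; rewrite !tnthS.
Qed.

Definition section n (X : {set n.+1.-tuple F}) (a : F) : {set n.-tuple F} :=
  [set t : n.-tuple F | [tuple of a :: t] \in X]%SET.

Lemma card_sections n (X : {set n.+1.-tuple F}) :
  #|X|%:R = \sum_a #|section X a|%:R :> R.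
Proof.
rewrite -sum1_card natr_sum big_mkcond /= sum_tuple_cons.
apply: eq_bigr => a _; rewrite -sum1_card natr_sum [RHS]big_mkcond /=.
by apply: eq_bigr => t _; rewrite inE.
Qed.

Hypothesis pool_hits : forall T : {set F}, (q <= 2 * 2 ^ e * #|T|)%N ->
  #|[set b : pool | [forall j, b j \notin T]]%SET|%:R <= eta * #|{: pool}|%:R.

(* Averaging over independent random pools [B] is needed because the sections
   of [X] must share the pools of the remaining coordinates. *)
Definition coverable n (X : {set n.-tuple F}) (c : R) :=
  exists x : n.-tuple pool -> n.-tuple F -> n.-tuple F,
    (forall B w, x B w \in X) /\
    \sum_B \sum_w misses B w (x B w) <= (#|{: pool}| ^ n * q ^ n)%:R * c.

(** The first coordinate [A b w] depends only on the first pool and the first letter. The remaining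
    pools and letters are independent of these, so the strategy for the section at [A b w] keeps its
    average cost [c' (A b w)]. *)
Lemma coverable_step n (X : {set n.+1.-tuple F}) (c : R) (c' : F -> R)
    (A : pool -> F -> F) :
  (forall a, (0 < #|section X a|)%N -> coverable (section X a) (c' a)) ->
  (forall b w, (0 < #|section X (A b w)|)%N) ->
  \sum_(b : pool) \sum_w (miss b (A b w - w) + c' (A b w)) <= (#|{: pool}| * q)%:R * c ->
  coverable X c.
Proof.
move=> IH A0 Ac.
(* Empty sections get an arbitrary strategy, since [A] never enters one. *)
have /choice[x xP] : forall a, exists x : n.-tuple pool -> n.-tuple F -> n.-tuple F,
    (0 < #|section X a|)%N -> (forall B w, x B w \in section X a) /\
    \sum_B \sum_w misses B w (x B w) <= (#|{: pool}| ^ n * q ^ n)%:R * c' a.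
  move=> a; have [/IH[x xP]|a0] := ltnP 0 #|section X a|; first by exists x.
  by exists (fun _ w => w).
exists (fun B w => [tuple of A (thead B) (thead w) ::
   x (A (thead B) (thead w)) [tuple of behead B] [tuple of behead w]]); split.
  move=> B w; have [/(_ [tuple of behead B] [tuple of behead w])+ _] :=
    xP _ (A0 (thead B) (thead w)).
  by rewrite inE.
rewrite sum_tuple_cons /=.
under eq_bigr do (under eq_bigr do rewrite sum_tuple_cons; rewrite exchange_big /=).
have -> : (#|{: pool}| ^ n.+1 * q ^ n.+1)%:R * c =
    (#|{: pool}| ^ n * q ^ n)%:R * ((#|{: pool}| * q)%:R * c).
  by rewrite !natrM !natrX !exprS; ring.
apply: le_trans (ler_wpM2l (ler0n _ _) Ac).
rewrite mulr_sumr; apply: ler_sum => b _; rewrite mulr_sumr; apply: ler_sum => w _.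
have [_ xA] := xP _ (A0 b w).
rewrite mulrDr; apply: le_trans (lerD (lexx _) xA).
have -> : (#|{: pool}| ^ n * q ^ n)%:R * miss b (A b w - w) =
    \sum_(B : n.-tuple pool) \sum_(t : n.-tuple F) miss b (A b w - w).
  by under eq_bigr do rewrite sumr_const; rewrite sumr_const !card_tuple -mulrnA mulnC mulr_natl.
rewrite -big_split /=; apply: ler_sum => B _; rewrite -big_split /=.
apply: ler_sum => ws _; rewrite !theadE misses_cons.
rewrite le_eqVlt; apply/orP; left; apply/eqP.
by congr (_ + misses _ _ (x _ _ _)); exact: val_inj.
Qed.

(** Induction on the coordinates, with the deficit [log2 (q^n / #|X|)] as a budget: a deliberate
    miss is paid for by a drop of [e] in the deficit; any other coordinate costs [eta] for a pool
    that fails and [1/e] for a density that may halve. *)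
Lemma covering n (X : {set n.-tuple F}) : (0 < #|X|)%N ->
  coverable X (log2 ((q ^ n)%:R / #|X|%:R) / e%:R + n%:R * (e%:R^-1 + eta)).
Proof.
have eR0 : 0 < e%:R :> R by rewrite ltr0n.
have q0 : 0 < q%:R :> R by rewrite ltr0n; apply/card_gt0P; exists 0.
elim: n => [|n IHn] in X *.
  move=> X0; have [x0 x0X] := card_gt0P X0; exists (fun _ _ => x0); split=> //.
  rewrite big1 => [|B _]; last by rewrite big1 // => w _; rewrite /misses big_ord0.
  have -> : #|X| = 1%N.
    apply/eqP; rewrite eqn_leq X0 andbT.
    by apply: leq_trans (max_card _) _; rewrite card_tuple expn0.
  by rewrite !expn0 divr1 log21 !mul0r addr0 mulr0.
move=> Xn0; set c := _ / _ + _.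
have X0 : 0 < #|X|%:R :> R by rewrite ltr0n.
pose m a : R := #|section X a|%:R.
have mP a : 0 < m a -> (0 < #|section X a|)%N by rewrite /m ltr0n.
pose l : R := log2 (q%:R ^+ n.+1 / #|X|%:R).
(* The hypothesis says that the density of the section at [a] is at least [v] times the density of
   [X]. *)
have lE (v : R) a : 0 < v -> v * #|X|%:R <= m a * q%:R ->
    log2 ((q ^ n)%:R / m a) <= l - log2 v.
  move=> v0 vm; have ma0 : 0 < m a.
    by rewrite -(pmulr_lgt0 _ q0); apply: lt_le_trans vm; exact: mulr_gt0.
  rewrite lerBrDr -log2M ?divr_gt0 ?natrX ?exprn_gt0 //.
  apply: ler_log2; first by rewrite !mulr_gt0 ?invr_gt0 ?exprn_gt0.
  rewrite ler_pdivlMr // [leLHS](_ : _ = q%:R ^+ n * (v * #|X|%:R) / m a); last by ring.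
  rewrite ler_pdivrMr // exprS mulrC [leRHS]mulrAC ler_pM2r ?exprn_gt0 //.
  by rewrite [leRHS]mulrC.
have [a0 a0max] : exists a0, forall a, m a <= m a0.
  have [//|a0 _ a0P] := @arg_maxnP F 0 xpredT (fun a => #|section X a|).
  by exists a0 => a; rewrite /m ler_nat; exact: a0P.
have cardX : #|X|%:R = \sum_a m a by rewrite card_sections.
have a0X : #|X|%:R <= m a0 * q%:R.
  rewrite cardX; apply: le_trans (ler_sum _ (fun a _ => a0max a)) _.
  by rewrite sumr_const mulr_natr.
have ma0 : 0 < m a0 by rewrite -(pmulr_lgt0 _ q0); exact: lt_le_trans a0X.
pose c' a := log2 ((q ^ n)%:R / m a) / e%:R + n%:R * (e%:R^-1 + eta).
have cE : c = l / e%:R + n.+1%:R * (e%:R^-1 + eta) by rewrite /c natrX.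
have eta0 : 0 <= eta.
  have := @pool_hits [set: F]%SET; rewrite cardsT => /(_ _)/wrap[].
    by rewrite leq_pmull // muln_gt0 expn_gt0.
  move=> h; have := le_trans (ler0n _ _) h; rewrite pmulr_lge0 // ltr0n.
  by apply/card_gt0P; exists [ffun=> 0].
(* If one section is [2^e] times denser than [X], entering it costs one miss but
   lowers the logarithm by [e]. Otherwise the sections of density at least half
   that of [X] are numerous enough for [w + b] to meet one almost surely. *)
have [big|small] := leP ((2 ^ e)%:R * #|X|%:R) (m a0 * q%:R).
  apply: (@coverable_step _ _ _ c' (fun _ _ => a0)) => [|b w|]; first by move=> a ha; apply: IHn.
    exact: mP.
  rewrite (_ : _ * c = \sum_(b : pool) \sum_(w : F) c); last first.
    by rewrite !sumr_const -mulrnA mulnC mulr_natl.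
  apply: ler_sum => b _; apply: ler_sum => w _.
  have ce : c' a0 <= l / e%:R - 1 + n%:R * (e%:R^-1 + eta).
    rewrite lerD2r -[X in _ - X](@divff _ e%:R) ?gt_eqF // -mulrBl ler_pM2r ?invr_gt0 //.
    have := lE _ _ _ big; rewrite natrX log2X // log2_2 mulr1; apply.
    by rewrite exprn_gt0.
  have : miss b (a0 - w) <= 1 by rewrite /miss lern1 leq_b1.
  rewrite cE -natr1 mulrDl; have : 0 <= e%:R^-1 :> R by rewrite invr_ge0 ltW.
  lra.
pose T := [set a | #|X|%:R <= 2 * (m a * q%:R)]%SET.
(* Sections outside [T] hold at most half of [X], and each section in [T] has at most [2^e #|X| / q]
   points. *)
have T_large : (q <= 2 * 2 ^ e * #|T|)%N.
  rewrite -(ler_nat R) !natrM; set g := (2 ^ e)%:R in small *.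
  have : #|X|%:R * q%:R <= #|T|%:R * (g * #|X|%:R) + q%:R * (#|X|%:R / 2).
    rewrite {1}cardX mulr_suml (bigID (mem T)) /=; apply: lerD.
      rewrite [leRHS](_ : _ = \sum_(a in T) (g * #|X|%:R)); last by rewrite sumr_const mulr_natl.
      by apply: ler_sum => a _; apply: le_trans (ltW small); rewrite ler_pM2r.
    rewrite (le_trans (y := \sum_(i | i \notin T) (#|X|%:R / 2))) //.
      apply: ler_sum => a; rewrite inE -ltNge => h; lra.
    rewrite sumr_const -[leLHS]mulr_natl ler_wpM2r ?ler_nat ?max_card // divr_ge0 //.
  move=> h; rewrite -(ler_pM2r X0); lra.
(* When the pool fails, the densest section is entered: this may cost a miss but does not increase
   the deficit. *)
pose A (b : pool) w := if [pick j | w + b j \in T] is Some j then w + b j else a0.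
pose lost (b : pool) w : R := [forall j, b j \notin [set z | w + z \in T]%SET]%:R.
have lP b w : miss b (A b w - w) + c' (A b w) <= lost b w + (c - eta).
  have cT a : log2 ((q ^ n)%:R / m a) <= l + 1 -> c' a <= c - eta.
    move=> h; rewrite /c' cE -natr1.
    have : log2 ((q ^ n)%:R / m a) / e%:R <= (l + 1) / e%:R by rewrite ler_pM2r ?invr_gt0.
    rewrite mulrDl mul1r; lra.
  apply: lerD; last first.
    apply: cT; rewrite /A; case: pickP => [j|_].
      rewrite inE => h; have := @lE 2^-1 (w + b j); rewrite log2V // log2_2 opprK; apply => //.
      lra.
    by have := @lE 1 a0 ltr01; rewrite log21 subr0 mul1r => /(_ a0X) h; lra.
  rewrite /miss /lost ler_nat; case: forallP => [_|h]; first exact: leq_b1.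
  rewrite leqn0 eqb0 negbK /A; case: pickP => [j _|h'].
    by rewrite addrC addKr codom_f.
  by case: h => j; rewrite inE h'.
apply: (@coverable_step _ _ _ c' A) => [|b w|]; first by move=> a ha; apply: IHn.
  rewrite /A; case: pickP => [j|_]; last exact: mP.
  rewrite inE => h; apply: mP; rewrite -(pmulr_lgt0 _ q0); lra.
apply: (@le_trans _ _ (\sum_(b : pool) \sum_w (lost b w + (c - eta)))).
  by apply: ler_sum => b _; apply: ler_sum => w _.
under eq_bigr do rewrite big_split /=.
rewrite big_split /= exchange_big /= !sumr_const -mulrnA.
have -> : (#|{: pool}| * q)%:R * c =
    \sum_(w : F) (eta * #|{: pool}|%:R) + (c - eta) *+ (q * #|{: pool}|).
  by rewrite sumr_const -[X in _ = X + _]mulr_natr -[X in _ = _ + X]mulr_natr !natrM; ring.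
rewrite lerD2r; apply: ler_sum => w _.
apply: le_trans (pool_hits (T := [set z | w + z \in T]%SET) _); last first.
  suff -> : #|[set z | w + z \in T]%SET| = #|T| by [].
  rewrite -[LHS](card_imset _ (addrI w)); apply: eq_card => z.
  apply/imsetP/idP => [[y +->]|zT]; first by rewrite inE.
  have zw : w + (z - w) = z by rewrite addrCA subrr addr0.
  by exists (z - w); rewrite ?zw // finset.in_set zw.
by rewrite -sum1_card natr_sum [leRHS]big_mkcond /=; apply: ler_sum => b _; rewrite inE /lost; case: ifP.
Qed.
End Covering.

Section RandomPool.
Variables (R : realType) (F : finZmodType) (e : nat).
Local Notation q := #|F|.
Local Notation k := (2 * 2 ^ e * 64)%N.
Local Notation pool := {ffun 'I_k -> F}.

(** The left-hand side decreases in [n], because [(1 - x) (1 + (n + 1) x) <= 1 + n x]. *)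
Lemma exprBn_le (x : R) n : 0 <= x -> x <= 1 -> (1 - x) ^+ n * (1 + n%:R * x) <= 1.
Proof.
move=> x0 x1; elim: n => [|n IH]; first by rewrite expr0 mul0r addr0 mul1r.
apply: le_trans IH; rewrite exprS mulrAC mulrC; apply: ler_wpM2l.
  by rewrite exprn_ge0 // subr_ge0.
rewrite -natr1; have : 0 <= n%:R * x * x by rewrite !mulr_ge0.
have : 0 <= x * x by rewrite mulr_ge0.
lra.
Qed.

(** With [x] the density of [T], the [k] independent elements all miss [T] with probability
    [(1 - x)^k <= 1 / (1 + k x)], and the choice of [k] gives [k x >= 64]. *)
Lemma random_pool_hits (T : {set F}) : (q <= 2 * 2 ^ e * #|T|)%N ->
  #|[set b : pool | [forall j, b j \notin T]]%SET|%:R <= 64^-1 * #|{: pool}|%:R :> R.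
Proof.
move=> qT.
have -> : #|[set b : pool | [forall j, b j \notin T]]%SET| = (#|~: T| ^ k)%N.
  have := card_ffun_on 'I_k (mem (~: T)); rewrite card_ord => <-.
  apply: eq_card => b.
  rewrite inE; apply/forallP/ffun_onP => bT j; first by rewrite inE.
  by move: (bT j); rewrite inE.
have q0 : 0 < q%:R :> R by rewrite ltr0n; apply/card_gt0P; exists 0.
rewrite card_ffun card_ord !natrX.
have -> : #|~: T|%:R = q%:R * (1 - #|T|%:R / q%:R) :> R.
  by rewrite -(cardsC T) natrD; field; rewrite -natrD cardsC gt_eqF.
rewrite exprMn mulrC ler_wpM2r ?exprn_ge0 //.
set x : R := _ / _.
have x0 : 0 <= x by rewrite divr_ge0.
have x1 : x <= 1 by rewrite ler_pdivrMr // mul1r ler_nat max_card.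
have := exprBn_le k x0 x1.
have : 64 <= k%:R * x.
  rewrite natrM /x mulrA ler_pdivlMr // -mulrAC [leRHS]mulrC ler_pM2l //.
  by rewrite -natrM ler_nat.
move: (k%:R * x) => y y64 h.
rewrite -[leRHS]mul1r ler_pdivlMr //; apply: le_trans h.
by apply: ler_wpM2l; [rewrite exprn_ge0 // subr_ge0|lra].
Qed.

(** Some family of pools does at least as well as the average. Fixing it makes [x] a function of the
    word alone, as a code requires. *)
Lemma covering_pool n (X : {set n.-tuple F}) : (0 < e)%N -> (0 < #|X|)%N ->
  exists (B : n.-tuple pool) (x : n.-tuple F -> n.-tuple F),
    (forall w, x w \in X) /\
    \sum_(i < n) \sum_w miss R (tnth B i) (tnth (x w) i - tnth w i)
      <= (q ^ n)%:R * (log2 ((q ^ n)%:R / #|X|%:R) / e%:R + n%:R * (e%:R^-1 + 64^-1)).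
Proof.
move=> e0 X0; have [x [xX]] := covering e0 random_pool_hits X0.
set c := log2 _ / _ + _ => xc.
have [B BP] : exists B, \sum_w misses R B w (x B w) <= (q ^ n)%:R * c.
  apply: contrapT => /forallNP h; suff : (#|{: pool}| ^ n * q ^ n)%:R * c <
      \sum_B \sum_w misses R B w (x B w) by rewrite ltNge xc.
  have -> : (#|{: pool}| ^ n * q ^ n)%:R * c = \sum_(B : n.-tuple pool) ((q ^ n)%:R * c).
    by rewrite sumr_const card_tuple -[RHS]mulr_natl mulrA natrM.
  apply: ltr_sum => [|B _]; first by apply/hasP; exists [tuple [ffun=> 0] | _ < n] => //; rewrite mem_index_enum.
  by rewrite ltNge; apply/negP/h.
by exists B, (x B); split=> //; rewrite exchange_big.
Qed.
End RandomPool.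

(** * Entropy *)

Section Entropy.
Variables (R : realType) (T S : finType) (X : T -> S).
Hypothesis T_gt0 : (0 < #|T|)%N.

Let TR_gt0 : 0 < #|T|%:R :> R. Proof. by rewrite ltr0n. Qed.

Lemma unif_expectation (g : S -> R) :
  \sum_y unif_prob R X y * g y = (\sum_w g (X w)) / #|T|%:R.
Proof.
rewrite (partition_big X xpredT) //= mulr_suml; apply: eq_bigr => y _.
rewrite (eq_bigr (fun=> g y)) => [|w /eqP-> //].
rewrite sumr_const /unif_prob mulrAC mulr_natl; congr (_ *+ _ / _).
by apply: eq_card => w; rewrite inE.
Qed.

(** Gibbs' inequality: the entropy is at most the mean code length for any sub-probability [Q]. It
    follows from [ln (1 + z) <= z] at [z = Q y / p - 1]. *)
Lemma unif_entropy_le (Q : S -> R) : (forall y, 0 < Q y) -> \sum_y Q y <= 1 ->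
  unif_entropy R X <= (\sum_w - log2 (Q (X w))) / #|T|%:R.
Proof.
move=> Q0 Q1; rewrite -(unif_expectation (fun y => - log2 (Q y))) /unif_entropy -sumrN.
rewrite -subr_le0 -sumrB.
have p1 : \sum_y unif_prob R X y = 1.
  have := unif_expectation (fun=> 1); under eq_bigr do rewrite mulr1.
  by move=> ->; rewrite sumr_const divff // gt_eqF.
apply: (@le_trans _ _ ((\sum_y (Q y - unif_prob R X y)) / ln 2)); last first.
  by rewrite sumrB p1 mulr_le0_ge0 ?subr_le0 // invr_ge0 ltW // ln2_gt0.
rewrite mulr_suml; apply: ler_sum => y _.
set p := unif_prob R X y; have p0 : 0 <= p by rewrite divr_ge0.
have [->|pn0] := eqVneq p 0.
  by rewrite !mul0r oppr0 !addr0 divr_ge0 // ltW // ln2_gt0.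
have pp : 0 < p by rewrite lt_def pn0.
rewrite mulrN opprK addrC -mulrBr /log2 -mulrBl mulrA ler_pM2r ?invr_gt0 ?ln2_gt0 //.
rewrite -ln_div ?posrE //.
have : ln (1 + (Q y / p - 1)) <= Q y / p - 1.
  by apply: le_ln1Dx; rewrite ltrBrDl addrN divr_gt0.
rewrite (_ : 1 + _ = Q y / p); last by rewrite addrCA subrr addr0.
move=> h; apply: (@le_trans _ _ (p * (Q y / p - 1))); first by rewrite ler_pM2l.
by rewrite mulrBr mulr1 mulrCA divff // mulr1.
Qed.

Lemma unif_entropy_le_card : unif_entropy R X <= log2 #|S|%:R.
Proof.
have S0 : 0 < #|S|%:R :> R.
  by move: T_gt0 => /card_gt0P[w _]; rewrite ltr0n; apply/card_gt0P; exists (X w).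
apply: le_trans (@unif_entropy_le (fun=> #|S|%:R^-1) _ _) _.
- by move=> y; rewrite invr_gt0.
- by rewrite sumr_const -[leLHS]mulr_natl divff // gt_eqF.
- by rewrite sumr_const -[X in X / _]mulr_natr mulfK ?gt_eqF // log2V // opprK.
Qed.

(** Gibbs' inequality with weight [1 / (2 k)] on [D] and [1 / (2 #|S|)] elsewhere: one bit tells the
    two cases apart, followed by [log2 k] or [log2 #|S|] bits. *)
Lemma unif_entropy_le_concentrated (D : {set S}) k : (0 < k)%N -> (#|D| <= k)%N ->
  unif_entropy R X <= 1 + log2 k%:R +
    (\sum_w (X w \notin D)%:R) / #|T|%:R * log2 #|S|%:R.
Proof.
move=> k0 Dk.
have S0 : 0 < #|S|%:R :> R.
  by move: T_gt0 => /card_gt0P[w _]; rewrite ltr0n; apply/card_gt0P; exists (X w).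
have kR : 0 < k%:R :> R by rewrite ltr0n.
pose Q (y : S) : R := if y \in D then (2 * k%:R)^-1 else (2 * #|S|%:R)^-1.
apply: le_trans (@unif_entropy_le Q _ _) _.
- by move=> y; rewrite /Q; case: ifP => _; rewrite invr_gt0 mulr_gt0.
- rewrite (bigID (mem D)) /=.
  rewrite (eq_bigr (fun=> (2 * k%:R)^-1)) => [|y yD]; last by rewrite /Q yD.
  rewrite sumr_const (eq_bigr (fun=> (2 * #|S|%:R)^-1)) => [|y yD]; last first.
    by rewrite /Q (negbTE yD).
  rewrite sumr_const; have half m d : (m <= d)%N -> 0 < d%:R :> R ->
      (2 * d%:R)^-1 *+ m <= 2^-1 :> R.
    move=> md d0; rewrite -[leLHS]mulr_natl invfM mulrCA ger_pMr ?invr_gt0 //.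
    by rewrite ler_pdivrMr // mul1r ler_nat.
  rewrite [leRHS](_ : 1 = 2^-1 + 2^-1); last by lra.
  by apply: lerD; apply: half => //; exact: max_card.
- rewrite ler_pdivrMr // mulrDl mulrAC divfK ?gt_eqF // mulr_suml.
  have -> : (1 + log2 k%:R) * #|T|%:R = \sum_(w : T) (1 + log2 k%:R) :> R.
    by rewrite sumr_const mulr_natr.
  rewrite -big_split /=; apply: ler_sum => w _; rewrite /Q.
  have k1 : 0 <= log2 k%:R :> R by apply: log2_ge0; rewrite ler1n.
  by case: ifP => _; rewrite log2V ?mulr_gt0 // opprK log2M // log2_2 /=; lra.
Qed.
End Entropy.

(** * Flows and potentials *)

Section FlowDuality.
Variables (R : realType) (N : dag_network R).
Local Notation V := (dvert N).
Variables (L : V -> V -> R) (phi : 'I_(dpairs N) -> V -> R).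
Hypothesis L_sym : forall u v, L u v = L v u.
Hypothesis L_ge0 : forall u v, 0 <= L u v.
Hypothesis phi_lip : forall i u v, dedge u v -> `|phi i u - phi i v| <= L u v.
Hypothesis src_tgt : forall i, dsrc i != dtgt i :> V.
Hypothesis phi_drop : forall i, phi i (dtgt i) <= phi i (dsrc i).

(** Weak linear programming duality. Each unit of commodity [i] must descend the whole drop of
    [phi i], a unit on an edge descends at most the length [L] of the edge, and the capacity bounds
    the load. *)
Lemma flow_le_metric r : flow_achieves (un N) r ->
  r * (\sum_i (phi i (dsrc i) - phi i (dtgt i)))
    <= \sum_u \sum_(v | dedge u v) L u v * dcap u v.
Proof.
case=> f [f0 fE _ fcons fcap] fr.
pose net i v := \sum_u f i v u - \sum_u f i u v.
have pot i : r * (phi i (dsrc i) - phi i (dtgt i)) <=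
    \sum_u \sum_v f i u v * (phi i u - phi i v).
  have -> : \sum_u \sum_v f i u v * (phi i u - phi i v) = \sum_v phi i v * net i v.
    under eq_bigr do under eq_bigr do rewrite mulrBr.
    under eq_bigr do rewrite sumrB.
    rewrite sumrB [X in _ - X]exchange_big -sumrB; apply: eq_bigr => v _ /=.
    by rewrite mulrBr -!mulr_suml -!(mulrC (phi i v)).
  have net0 v : v != dsrc i -> v != dtgt i -> net i v = 0.
    by move=> vs vt; rewrite /net (fcons i v) ?subrr.
  have two (g : V -> R) : \sum_v g v * net i v =
      g (dsrc i) * net i (dsrc i) + g (dtgt i) * net i (dtgt i).
    rewrite (bigD1 (dsrc i)) //= (bigD1 (dtgt i)) ?(eq_sym (dtgt i)) ?src_tgt //=.
    by rewrite big1 ?addr0 // => v /andP[vs vt]; rewrite net0 ?mulr0.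
  have bal : net i (dsrc i) + net i (dtgt i) = 0.
    have := two (fun=> 1); under eq_bigr do rewrite mul1r; rewrite !mul1r => <-.
    by rewrite /net sumrB exchange_big subrr.
  have nt : r <= - net i (dtgt i).
    by apply: le_trans (fr i) _; rewrite sumrB /net opprB.
  rewrite two (_ : net i (dsrc i) = - net i (dtgt i)); last first.
    by apply/eqP; rewrite -addr_eq0 bal.
  move: nt (phi_drop i); rewrite -subr_ge0 => nt; rewrite -subr_ge0 => pd.
  by have := mulr_ge0 nt pd; lra.
rewrite mulr_sumr; apply: le_trans (ler_sum _ (fun i _ => pot i)) _.
pose g u v := \sum_i f i u v.
have g0 u v : 0 <= g u v by apply: sumr_ge0.
have gE u v : ~~ un_edge u v -> g u v = 0.
  by move=> uv; rewrite /g big1 // => i _; exact: fE.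
have lip i u v : un_edge u v -> phi i u - phi i v <= L u v.
  case/orP => [/phi_lip h|/phi_lip h]; first exact: le_trans (ler_norm _) (h i).
  by rewrite L_sym; apply: le_trans (h i); rewrite distrC ler_norm.
rewrite exchange_big /=.
apply: (@le_trans _ _ (\sum_u \sum_v L u v * g u v)).
  apply: ler_sum => u _; rewrite exchange_big /=; apply: ler_sum => v _.
  rewrite mulr_sumr; apply: ler_sum => i _; rewrite mulrC.
  have [uv|uv] := boolP (un_edge u v); first by apply: ler_wpM2r => //; exact: lip.
  by rewrite (fE i u v uv) !mulr0.
(* At most one of [(u, v)] and [(v, u)] is an arc, so the sum over ordered pairs splits into arcs
   and reversed arcs; the capacity of an arc bounds its two loads together. *)
have split u v : L u v * g u v = (if dedge u v then L u v * g u v else 0) +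
    (if dedge v u then L v u * g u v else 0).
  case: ifPn => uv; first by rewrite (dedge_asym uv) addr0.
  case: ifPn => vu; rewrite add0r; first by rewrite L_sym.
  by rewrite gE ?mulr0 // /un_edge negb_or uv.
have -> : \sum_u \sum_v L u v * g u v =
    \sum_u \sum_v (if dedge u v then L u v * g u v else 0) +
    \sum_u \sum_v (if dedge v u then L v u * g u v else 0).
  rewrite -big_split; apply: eq_bigr => u _; rewrite -big_split.
  by apply: eq_bigr => v _; exact: split.
rewrite [X in _ + X]exchange_big -big_split /=.
apply: ler_sum => u _; rewrite -big_split [leRHS]big_mkcond /=; apply: ler_sum => v _.
case: ifPn => uv; last by rewrite addr0.
rewrite -mulrDr; apply: ler_wpM2l; first exact: L_ge0.
rewrite /g -big_split /=; have := fcap u v; rewrite /= /un_edge uv => /(_ isT).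
by rewrite /un_cap uv.
Qed.
End FlowDuality.

(** * The network of a data structure and its code *)

Section Network.
Variables (n : nat) (P : 'I_n -> {set 'I_n}) (H : {set 'I_n}).

Definition layered : finType := (bool * bool * 'I_n)%type.
(* [None] is the supervisor; the layers are, in order, the sources
   [(false, false)], the inputs [(false, true)], the transform values
   [(true, false)] and the targets [(true, true)]. *)
Definition vertex : finType := option layered.

(** The same structure computes both transforms, hence the same [P] twice. Values at positions in
    [H] are going to be constant, so no arc transmits them. *)
Definition link (x y : layered) : bool :=
  match x, y with
  | (false, false, i), (false, true, j) => i == j
  | (false, true, i), (true, false, j) => (i \in P j) && (i \notin H)
  | (true, false, j), (true, true, k) => (j \in P k) && (j \notin H)
  | _, _ => false
  end.

Definition edge (x y : vertex) : bool :=
  match x, y with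
  | Some a, Some b => link a b
  | Some (false, false, _), None => true
  | None, Some (false, true, _) => true
  | None, Some (true, true, _) => true
  | _, _ => false
  end.

Definition depth (x : vertex) : nat :=
  match x with
  | None => 1
  | Some (false, false, _) => 0
  | Some (false, true, _) => 2
  | Some (true, false, _) => 3
  | Some (true, true, _) => 4
  end.

Lemma edge_depth x y : edge x y -> (depth x < depth y)%N.
Proof. by case: x y => [[[[] []] i]|] [[[[] []] j]|]. Qed.

Lemma edge_acyclic x p : p != [::] -> path edge x p -> last x p != x.
Proof.
have path_depth y s : path edge y s -> (depth y <= depth (last y s))%N.
  elim: s y => //= z s IH y /andP[/edge_depth yz /IH]; exact: leq_trans (ltnW yz).
case: p => // y s _ /= /andP[/edge_depth xy /path_depth ys].
by apply/eqP => e; move: (leq_trans xy ys); rewrite e ltnn.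
Qed.

Variables (R : realType) (cap : R) (cu : 'I_n -> R) (rho : 'I_n -> 'I_n).
Hypothesis cap_gt0 : 0 < cap.
Hypothesis cu_gt0 : forall i, 0 < cu i.

(** For an involution [rho], the last-layer vertex [k] is the target of the pair [rho k], which is
    why it receives the correction of index [rho k]. *)
Definition capacity (x y : vertex) : R :=
  match x, y with
  | None, Some (false, true, i) => cu i
  | None, Some (true, true, k) => cu (rho k)
  | _, _ => cap
  end.

Lemma capacity_gt0 x y : edge x y -> 0 < capacity x y.
Proof. by case: x y => [[[[] []] i]|] [[[[] []] j]|] //=. Qed.

Definition source (i : 'I_n) : vertex := Some (false, false, i).
Definition target (i : 'I_n) : vertex := Some (true, true, rho i).

Lemma source_in0 i x : ~~ edge x (source i).
Proof. by case: x => [[[[] []] j]|]. Qed.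

Definition ds_network : dag_network R :=
  @DagNetwork R vertex edge capacity n source target capacity_gt0 edge_acyclic source_in0.
End Network.

Section Coding.
Variables (R : realType) (F : finZmodType) (n k : nat).
Variables (P : 'I_n -> {set 'I_n}) (H : {set 'I_n}) (rho : 'I_n -> 'I_n).
Variables (Phi : n.-tuple F -> 'I_n -> F) (X : {set n.-tuple F}).
Variables (B : n.-tuple {ffun 'I_k -> F}) (x : n.-tuple F -> n.-tuple F).
Local Notation q := #|F|.
Hypothesis rhoK : involutive rho.
Hypothesis k_gt0 : (0 < k)%N.
Hypothesis q_gt1 : (1 < q)%N.
Hypothesis x_in : forall w, x w \in X.
Hypothesis Phi_det : forall y y' j, y \in X -> y' \in X ->
  (forall i, i \in P j -> i \notin H -> tnth y i = tnth y' i) -> Phi y j = Phi y' j.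
Hypothesis inv_det : forall y y' l, y \in X -> y' \in X ->
  (forall j, j \in P l -> j \notin H -> Phi y j = Phi y' j) ->
  tnth y (rho l) = tnth y' (rho l).

(** This is the bound of [unif_entropy_le_concentrated] for the [i]-th correction, with the [i]-th
    pool as [D]. *)
Definition correction_cap (i : 'I_n) : R :=
  1 + log2 k%:R + (\sum_w miss R (tnth B i) (tnth (x w) i - tnth w i)) / (q ^ n)%:R * log2 q%:R.

Lemma log2q_gt0 : 0 < log2 q%:R :> R.
Proof. by rewrite divr_gt0 ?ln2_gt0 // ln_gt0 // ltr1n. Qed.

Lemma correction_cap_gt0 i : 0 < correction_cap i.
Proof.
have k0 : 0 <= log2 k%:R :> R by apply: log2_ge0; rewrite ler1n.
have p0 : 0 <= (\sum_w miss R (tnth B i) (tnth (x w) i - tnth w i)) / (q ^ n)%:R * log2 q%:R.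
  by apply: mulr_ge0 (ltW log2q_gt0); apply: divr_ge0 => //; apply: sumr_ge0.
by rewrite /correction_cap; lra.
Qed.

Local Notation N := (ds_network P H rho log2q_gt0 correction_cap_gt0).
Local Notation vertex := (vertex n).

Definition input_tuple (w : 'I_n -> F) : n.-tuple F := [tuple w i | i < n].

Definition message (u v : vertex) (w : 'I_n -> F) : F :=
  match u, v with
  | Some (false, false, i), _ => w i
  | None, Some (false, true, i) => tnth (x (input_tuple w)) i - w i
  | None, Some (true, true, l) => tnth (x (input_tuple w)) (rho l) - w (rho l)
  | Some (false, true, i), _ => tnth (x (input_tuple w)) i
  | Some (true, false, j), _ => Phi (x (input_tuple w)) j
  | _, _ => 0
  end.

(** A vertex guesses any element of [X] consistent with what it reads; [Phi_det] and [inv_det] make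
    the guess good enough. The default value is itself in [X]. *)
Definition reconstruct (p : pred (n.-tuple F)) : n.-tuple F :=
  odflt (x [tuple 0 | _ < n]) [pick y in X | p y].

Lemma reconstructP (p : pred (n.-tuple F)) y : y \in X -> p y ->
  reconstruct p \in X /\ p (reconstruct p).
Proof.
move=> yX py; rewrite /reconstruct; case: pickP => [z /andP[] //|/(_ y)].
by rewrite yX py.
Qed.

Definition encode (u v : vertex) (src : 'I_n -> F) (inc : vertex -> F) : F :=
  match u, v with
  | Some (false, false, i), _ => src i
  | None, Some (false, true, i) =>
      let w := input_tuple (fun i => inc (Some (false, false, i))) in tnth (x w) i - tnth w i
  | None, Some (true, true, l) =>
      let w := input_tuple (fun i => inc (Some (false, false, i))) in
      tnth (x w) (rho l) - tnth w (rho l)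
  | Some (false, true, i), _ => inc (Some (false, false, i)) + inc None
  | Some (true, false, j), _ =>
      Phi (reconstruct (fun y => [forall i in P j :\: H, tnth y i == inc (Some (false, true, i))])) j
  | _, _ => 0
  end.

Definition decode (i : 'I_n) (inc : vertex -> F) : F :=
  tnth (reconstruct (fun y => [forall j in P (rho i) :\: H, Phi y j == inc (Some (true, false, j))])) i
    - inc None.

(** Extension by 0 to all vertices frees the encoders from adjacency proofs. *)
Definition total_inc (u : vertex) (inc : forall y, edge P H y u -> F) (y : vertex) : F :=
  match @idP (edge P H y u) with ReflectT e => inc y e | ReflectF _ => 0 end.

Definition total_src (u : vertex) (src : forall i, source i = u -> F) (i : 'I_n) : F :=
  match @eqP _ (source i) u with ReflectT e => src i e | ReflectF _ => 0 end.

Lemma total_incE u (g : vertex -> F) y : edge P H y u -> total_inc (fun y (_ : edge P H y u) => g y) y = g y.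
Proof. by rewrite /total_inc; case: {-}_ / idP. Qed.

Lemma total_srcE (w : 'I_n -> F) i : total_src (fun i' (_ : source i' = source i) => w i') i = w i.
Proof. by rewrite /total_src; case: eqP. Qed.

Lemma card_field_gt0 (i : 'I_n) : (0 < q)%N. Proof. exact: ltnW. Qed.

Definition ds_scheme : coding_scheme N :=
  @CodingScheme R N (fun _ => F) card_field_gt0 (fun _ _ _ => F)
    (fun u v _ src inc => encode u v (total_src src) (total_inc inc))
    (fun i inc => decode i (total_inc inc)).

Definition ds_messages : edge_messages ds_scheme := fun u v _ w => message u v (fun i => w i).

Lemma input_tuple_tnth w i : tnth (input_tuple w) i = w i.
Proof. by rewrite tnth_mktuple. Qed.

Lemma ds_transmits : transmits ds_messages.
Proof.
move=> u v e w; rewrite /ds_messages /=.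
case: u e => [[[[] []] i]|] e //=.
- case: v e => [[[[] []] l]|] //= e.
  (* The true point [x w] shows that the search succeeds. The point found may differ from it, but
     [Phi_det] gives both the same transform value. *)
  set p := (Z in reconstruct Z); have [pX pp] : reconstruct p \in X /\ p (reconstruct p).
    apply: (@reconstructP p (x (input_tuple (fun i => w i)))) => //.
    by apply/forall_inP => i' /setDP[iP iH]; rewrite total_incE /= ?iP ?iH.
  apply: Phi_det => // i' iP iH; move/forall_inP: pp => /(_ i').
  by rewrite inE iH iP total_incE /= ?iP ?iH // => /(_ isT)/eqP.
- by rewrite !total_incE /= ?eqxx // addrC subrK.
- by rewrite total_srcE.
- have tE : input_tuple (fun i => total_inc (u := None) (fun y _ => message y None (fun i => w i)) (Some (false, false, i)))
     = input_tuple (fun i => w i).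
    by apply: eq_from_tnth => i; rewrite !input_tuple_tnth total_incE.
  by case: v e => [[[[] []] l]|] //= e; rewrite tE input_tuple_tnth.
Qed.

(** By [inv_det] the values read determine coordinate [i] of [x w], and subtracting the correction
    [x_i - w_i] leaves [w_i]. *)
Lemma ds_correct : correct_scheme ds_messages.
Proof.
move=> w i; rewrite /= /decode.
set p := (Z in reconstruct Z); have [pX pp] : reconstruct p \in X /\ p (reconstruct p).
  apply: (@reconstructP p (x (input_tuple (fun i => w i)))) => //.
  by apply/forall_inP => i' /setDP[iP iH]; rewrite total_incE /= ?iP ?iH.
rewrite total_incE //= rhoK.
have := @inv_det (reconstruct p) (x (input_tuple (fun i => w i))) (rho i) pX (x_in _).
rewrite rhoK => ->; first by rewrite opprB addrC subrK.
move=> j jP jH; move/forall_inP: pp => /(_ j).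
by rewrite inE jH jP total_incE /= ?jP ?jH // => /(_ isT)/eqP.
Qed.

Lemma input_tuple_bij : bijective (fun w : inputs ds_scheme => input_tuple (fun i => w i)).
Proof.
exists (fun t : n.-tuple F => [ffun i => tnth t i] : inputs ds_scheme) => [w|t].
  by apply/ffunP => i; rewrite ffunE input_tuple_tnth.
by apply: eq_from_tnth => i; rewrite input_tuple_tnth ffunE.
Qed.

Lemma card_inputs : #|inputs ds_scheme| = (q ^ n)%N.
Proof. by rewrite (bij_eq_card input_tuple_bij) card_tuple. Qed.

(** Only the arcs leaving the supervisor need the concentrated bound; every other arc carries one
    element of [F] and has capacity [log2 q]. *)
Lemma ds_within_capacity : within_capacity ds_messages.
Proof.
have T0 : (0 < #|inputs ds_scheme|)%N by rewrite card_inputs expn_gt0 ltnW.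
have z_entropy i : unif_entropy R (fun w : inputs ds_scheme =>
    tnth (x (input_tuple (fun i => w i))) i - w i) <= correction_cap i.
  apply: le_trans (@unif_entropy_le_concentrated R _ _ _ T0 [set z in codom (tnth B i)]%SET k k_gt0 _) _.
    by rewrite cardsE (leq_trans (card_size _)) // size_codom card_ord.
  rewrite /correction_cap lerD2l card_inputs.
  rewrite [X in _ <= X / _ * _](reindex (fun w : inputs ds_scheme => input_tuple (fun i => w i))) /=; last first.
    exact: onW_bij input_tuple_bij.
  rewrite le_eqVlt; apply/orP; left; apply/eqP; congr (_ / _ * _); apply: eq_bigr => w _.
  by rewrite /miss inE input_tuple_tnth.
move=> u v e; have card := @unif_entropy_le_card R _ _ (ds_messages e) T0.
by case: u v e card => [[[[] []] i]|] [[[[] []] j]|] //= e _; exact: z_entropy.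
Qed.

Lemma ds_coding_achieves : coding_achieves N (log2 q%:R).
Proof.
exists ds_scheme, ds_messages; split=> //=; [exact: ds_transmits|exact: ds_correct|].
exact: ds_within_capacity.
Qed.
End Coding.

(** * Distances in the network *)

Section Balls.
Variables (V : finType) (adj : rel V).

Fixpoint nball (m : nat) (y : V) : {set V} :=
  if m is m'.+1 then nball m' y :|: \bigcup_(z in nball m' y) [set z' | adj z z']%SET
  else [set y]%SET.

Lemma ball_step m y z z' : z \in nball m y -> adj z z' -> z' \in nball m.+1 y.
Proof. by move=> zB zz'; rewrite /= inE; apply/orP; right; apply/bigcupP; exists z; rewrite ?inE. Qed.

Lemma ballS m y : nball m y \subset nball m.+1 y.
Proof. exact: finset.subsetUl. Qed.

Lemma ball_mono m m' y : (m <= m')%N -> nball m y \subset nball m' y.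
Proof.
move=> /subnK <-; elim: (m' - m)%N => // d IH.
by apply: fintype.subset_trans IH _; exact: ballS.
Qed.

Lemma ball_center m y : y \in nball m y.
Proof. by apply: (fintype.subsetP (ball_mono y (leq0n m))); rewrite inE. Qed.

Lemma card_ball_le D m y : (forall z, (#|[set z' | adj z z']%SET| <= D)%N) ->
  (#|nball m y| <= D.+1 ^ m)%N.
Proof.
move=> degD; elim: m => [|m IH] /=; first by rewrite cards1.
apply: leq_trans (leq_card_setU _ _) _; rewrite expnS mulSn leq_add //.
apply: (@leq_trans (\sum_(z in nball m y) D)%N); last by rewrite sum_nat_const mulnC leq_mul.
elim/big_rec2: _ => [|z a A zB]; first by rewrite cards0.
by move=> h; apply: leq_trans (leq_card_setU _ _) _; rewrite leq_add.
Qed.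

(* The distance from [y], truncated at [l]. *)
Definition truncated_dist (l : nat) (y z : V) : nat := (\sum_(m < l) (z \notin nball m y))%N.

Lemma truncated_dist_center l y : truncated_dist l y y = 0%N.
Proof. by rewrite /truncated_dist big1 // => m _; rewrite ball_center. Qed.

Lemma truncated_dist_le l y z : (truncated_dist l y z <= l)%N.
Proof.
rewrite -[leqRHS]card_ord -sum1_card; apply: leq_sum => m _; exact: leq_b1.
Qed.

Lemma truncated_dist_far l y z : z \notin nball l y -> truncated_dist l y z = l.
Proof.
move=> zB; rewrite -[RHS]card_ord -sum1_card; apply: eq_bigr => m _.
suff -> : z \notin nball m y by [].
by apply: contra zB; apply: fintype.subsetP (ball_mono _ (ltnW (ltn_ord m))) _.
Qed.

(** The term of index [m + 1] for [z'] is at most the term of index [m] for [z]; the first term for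
    [z'] accounts for the successor. *)
Lemma truncated_dist_lip l y z z' : adj z z' ->
  (truncated_dist l y z' <= (truncated_dist l y z).+1)%N.
Proof.
move=> zz'; rewrite /truncated_dist; case: l => [|l]; first by rewrite big_ord0.
rewrite big_ord_recl big_ord_recr /= -add1n leq_add ?leq_b1 //.
apply: leq_trans (leq_addr _ _); apply: leq_sum => m _.
have [zB|zB] := boolP (z \in nball m y); last exact: leq_b1.
by rewrite (ball_step zB zz').
Qed.
End Balls.

(** * Upper bound on the flow rate of the undirected network *)

Section FlowBound.
Variables (n : nat) (P : 'I_n -> {set 'I_n}) (H : {set 'I_n}) (rho : 'I_n -> 'I_n).
Variables (R : realType) (cap : R) (cu : 'I_n -> R) (l t : nat).
Hypothesis cap_gt0 : 0 < cap.
Hypothesis cu_gt0 : forall i, 0 < cu i.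
Hypothesis rhoK : involutive rho.
Hypothesis P_le : forall j, (#|P j| <= t)%N.
Local Notation N := (ds_network P H rho cap_gt0 cu_gt0).

Definition adjacency : rel (layered n) := fun y z => link P H y z || link P H z y.

Lemma adjacency_sym : symmetric adjacency.
Proof. by move=> y z; rewrite /adjacency orbC. Qed.

(* A supervisor edge counts for [l / 2], so that no path through the supervisor
   is shorter than [l]. *)
Definition potential (i : 'I_n) (v : vertex n) : R :=
  if v is Some z then (truncated_dist adjacency l (true, true, rho i) z)%:R else l%:R / 2.

Definition elength (u v : vertex n) : R :=
  match u, v with Some _, Some _ => 1 | _, _ => l%:R / 2 end.

Lemma elength_ge0 u v : 0 <= elength u v.
Proof. by case: u v => [u|] [v|] //=; rewrite ?ler01 ?divr_ge0. Qed.

(** Truncation keeps the potentials of the layers in [[0, l]], hence within [l / 2] of the potential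
    of the supervisor. *)
Lemma potential_lip i u v : edge P H u v -> `|potential i u - potential i v| <= elength u v.
Proof.
have half z : `|(truncated_dist adjacency l (true, true, rho i) z)%:R - l%:R / 2| <= l%:R / 2 :> R.
  have := truncated_dist_le adjacency l (true, true, rho i) z; rewrite -(ler_nat R) => h.
  have := ler0n R (truncated_dist adjacency l (true, true, rho i) z) => h0.
  by rewrite ler_norml; apply/andP; split; lra.
case: u v => [u|] [v|] //; try by [move=> _; exact: half|move=> _; rewrite distrC; exact: half].
move=> uv; have uv1 : adjacency u v.
  by apply/orP; left; case: u uv => [[[] []] a]; case: v => [[[] []] b].
rewrite /=.
have := truncated_dist_lip l (true, true, rho i) uv1; rewrite adjacency_sym in uv1.
have := truncated_dist_lip l (true, true, rho i) uv1.
by rewrite -!(ler_nat R) -!natr1 ler_norml => h h'; apply/andP; split; lra.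
Qed.

Lemma sum_vertex (g : vertex n -> R) : \sum_v g v = g None +
  \sum_i (g (Some (false, false, i)) + g (Some (false, true, i)) +
          g (Some (true, false, i)) + g (Some (true, true, i))).
Proof.
rewrite (bigD1 None) //=; congr (_ + _).
rewrite (reindex_omap (fun y : layered n => Some y) id) => [|[]//].
rewrite (eq_bigl xpredT) /= => [|y]; last by rewrite eqxx.
rewrite (eq_bigr (fun p : bool * bool * 'I_n => g (Some (p.1, p.2)))) => [|[b i] _] //.
rewrite -(pair_bigA _ (fun b i => g (Some (b, i)))) /=.
rewrite (eq_bigr (fun p : bool * bool => \sum_i g (Some (p.1, p.2, i)))) => [|[b c] _] //.
rewrite -(pair_bigA _ (fun b c => \sum_i g (Some (b, c, i)))) /= !big_bool /= !big_split /=.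
by rewrite -!addrA; ring.
Qed.

Lemma sum_probes : \sum_i \sum_j (if (i \in P j) && (i \notin H) then 1 * cap else 0)
  <= n%:R * t%:R * cap.
Proof.
rewrite exchange_big /=; apply: (@le_trans _ _ (\sum_(j < n) t%:R * cap)); last first.
  by rewrite sumr_const card_ord -[leLHS]mulr_natl mulrA.
apply: ler_sum => j _; apply: (@le_trans _ _ (\sum_i (if i \in P j then cap else 0))).
  by apply: ler_sum => i _; rewrite mul1r; case: (i \in P j) (i \in H) => [] [] //=; exact: ltW.
by rewrite -big_mkcond sumr_const -[leLHS]mulr_natl ler_pM2r // ler_nat.
Qed.

(** Length 1: the [n] arcs from sources to inputs and at most [n t] probe arcs for each transform.
    Length [l / 2]: the [n] arcs into the supervisor and its two families of correction arcs. *)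
Lemma sum_elength : \sum_u \sum_(v | edge P H u v) elength u v * capacity cap cu rho u v
  <= n%:R * cap * (1 + 2 * t%:R) + l%:R / 2 * (n%:R * cap + 2 * \sum_i cu i).
Proof.
rewrite sum_vertex; under [X in _ + X]eq_bigr do rewrite !(big_mkcond (edge _ _ _)) !sum_vertex /=.
rewrite big_mkcond sum_vertex /=.
have -> : \sum_i (0 + l%:R / 2 * cu i + 0 + l%:R / 2 * cu (rho i)) = l%:R / 2 * (2 * \sum_i cu i).
  rewrite !big_split /= !big1_eq !add0r addr0 -!mulr_sumr.
  have -> : \sum_i cu (rho i) = \sum_i cu i by rewrite [RHS](reindex_inj (inv_inj rhoK)).
  by ring.
rewrite !big_split /=.
have s0 : \sum_(i < n) \sum_(j < n) (0 : R) = 0 by rewrite big1 // => i _; rewrite big1_eq.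
have s1 : \sum_(i < n) \sum_(j < n) (0 + (if i == j then 1 * cap else 0) + 0 + 0) = n%:R * cap.
  rewrite (eq_bigr (fun=> cap)) => [|i _]; first by rewrite sumr_const card_ord mulr_natl.
  rewrite (bigD1 i) //= eqxx big1 => [|j /negbTE]; first by rewrite add0r !addr0 mul1r.
  by rewrite eq_sym => ->; rewrite !addr0.
have s2 := sum_probes.
have s3 : \sum_(i < n) l%:R / 2 * cap = n%:R * (l%:R / 2 * cap).
  by rewrite sumr_const card_ord [RHS]mulr_natl.
have s4 : \sum_(i < n) \sum_(j < n)
    (0 + 0 + (if (i \in P j) && (i \notin H) then 1 * cap else 0) + 0) <= n%:R * t%:R * cap.
  apply: le_trans s2; apply: ler_sum => i _; apply: ler_sum => j _.
  by rewrite !add0r addr0.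
have s5 : \sum_(i < n) \sum_(j < n)
    (0 + 0 + 0 + (if (i \in P j) && (i \notin H) then 1 * cap else 0)) <= n%:R * t%:R * cap.
  by apply: le_trans s2; apply: ler_sum => i _; apply: ler_sum => j _; rewrite !add0r.
rewrite !s0 !big1_eq s1 s3; lra.
Qed.

(** In [flow_le_metric] a far pair drops by [l]; the other drops are nonnegative and can be
    discarded because [r >= 0]. *)
Lemma flow_bound r (far : {set 'I_n}) : 0 <= r -> flow_achieves (un N) r ->
  (forall i, i \in far -> (false, false, i) \notin nball adjacency l (true, true, rho i)) ->
  r * (#|far|%:R * l%:R)
    <= n%:R * cap * (1 + 2 * t%:R) + l%:R / 2 * (n%:R * cap + 2 * \sum_i cu i).
Proof.
move=> r0 fr farP; apply: le_trans sum_elength.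
have phi_tgt i : potential i (@dtgt R N i) = 0 by rewrite /= truncated_dist_center.
have := @flow_le_metric R N elength potential _ elength_ge0 potential_lip _ _ r fr.
move=> h; apply: le_trans (h _ _ _).
- apply: ler_wpM2l => //.
  rewrite (bigID (mem far)) /= -[leLHS]addr0; apply: lerD.
    rewrite [leLHS](_ : _ = \sum_(i in far) l%:R); last by rewrite sumr_const mulr_natl.
    apply: ler_sum => i ifar.
    by rewrite truncated_dist_center subr0 truncated_dist_far ?farP.
  by apply: sumr_ge0 => i _; rewrite truncated_dist_center subr0.
- by case=> [u|] [v|].
- by [].
- by move=> i; rewrite phi_tgt /=.
Qed.
End FlowBound.

(** * Fourier transform, degrees and shifts *)

Lemma large_fibre (A B : finType) (f : A -> B) : (0 < #|A|)%N ->
  exists b, (#|A| <= #|B| * #|[set a | f a == b]%SET|)%N.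
Proof.
move=> /card_gt0P[a0 _].
have [//|b _ bP] := @arg_maxnP B (f a0) xpredT (fun b => #|[set a | f a == b]%SET|).
exists b; apply: (@leq_trans (\sum_(b' : B) #|[set a | f a == b]%SET|)%N); last first.
  by rewrite sum_nat_const.
rewrite -[leqLHS]sum1_card (partition_big f xpredT) //=.
apply: leq_sum => b' _; rewrite sum1_card; apply: leq_trans (bP b' isT).
by apply/eq_leq/eq_card => a; rewrite inE.
Qed.

Section DFT.
Variables (F : fieldType) (n' : nat) (om : F).
Local Notation n := n'.+1.
Hypothesis prim : n.-primitive_root om.

Definition dft (v : n.-tuple F) (j : 'I_n) : F := \sum_(i < n) tnth v i * om ^+ (i * j).

Definition twist (d : 'I_n) (v : n.-tuple F) : n.-tuple F :=
  [tuple om ^+ (d * j) * dft v j | j < n].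

Definition rho (d k : 'I_n) : 'I_n := - (k + d).

Lemma rhoK d : involutive (rho d).
Proof. by move=> k; rewrite /rho opprD opprK addrK. Qed.

Lemma rhoC d k : rho d k = rho k d.
Proof. by rewrite /rho addrC. Qed.

Lemma sum_prim_root m : \sum_(j < n) (om ^+ m) ^+ j = if (n %| m)%N then n%:R else 0.
Proof.
case: ifPn => nm.
  rewrite (eq_bigr (fun=> 1)) => [|j _]; first by rewrite sumr_const card_ord.
  by rewrite (eqP (_ : om ^+ m == 1)) ?expr1n // -(prim_order_dvd prim).
have x1 : om ^+ m - 1 != 0 by rewrite subr_eq0 -(prim_order_dvd prim).
apply: (mulfI x1); rewrite -subrX1 mulr0 -exprM mulnC exprM (prim_expr_order prim) expr1n.
by rewrite subrr.
Qed.

(** In the double sum the coefficient of [v_i] is the sum over [j] of [om^(j (d + i + k))], which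
    vanishes unless [n] divides [d + i + k]. *)
Lemma dft_twist d v k : dft (twist d v) k = n%:R * tnth v (rho d k).
Proof.
rewrite /dft (eq_bigr (fun j : 'I_n => \sum_(i < n) tnth v i * (om ^+ (d + i + k)) ^+ j)); last first.
  move=> j _; rewrite tnth_mktuple mulrAC mulr_sumr; apply: eq_bigr => i _.
  rewrite mulrCA -!exprD -exprM; congr (_ * _ ^+ _); lia.
rewrite exchange_big /= (bigD1 (rho d k)) //= -[RHS]addr0; congr (_ + _).
  rewrite -mulr_sumr sum_prim_root ifT 1?mulrC // /dvdn.
  have : val (d + rho d k + k) = 0%N by rewrite /rho addrAC (addrC k d) subrr.
  by rewrite /= modnDml => ->.
apply: big1 => i ik; rewrite -mulr_sumr sum_prim_root ifF ?mulr0 //.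
apply/negbTE; apply: contra ik => nd; rewrite /rho -addr_eq0.
apply/eqP/val_inj; rewrite /= -[RHS](eqP nd) modnDmr; congr (_ %% _)%N; lia.
Qed.
End DFT.

Section HighDegree.
Variables (n t K : nat) (P : 'I_n -> {set 'I_n}).
Hypothesis P_le : forall j, (#|P j| <= t)%N.
Hypothesis t_gt0 : (0 < t)%N.

Definition readers (i : 'I_n) : {set 'I_n} := [set j | i \in P j]%SET.
(* The values at these positions are fixed along with the advice, which keeps
   the degrees of the network bounded. *)
Definition high : {set 'I_n} := [set i | (K * t < #|readers i|)%N]%SET.

(** Double counting of the pairs [i \in P j], of which there are at most [n t]. *)
Lemma card_high : (K * #|high| <= n)%N.
Proof.
rewrite -(leq_pmul2r t_gt0) mulnAC mulnC.
apply: (@leq_trans (\sum_i #|readers i|)%N).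
  rewrite -sum_nat_const [leqRHS](bigID (mem high)) /=; apply: leq_trans (leq_addr _ _).
  by apply: leq_sum => i; rewrite inE => /ltnW.
have -> : (\sum_i #|readers i| = \sum_j #|P j|)%N.
  rewrite (eq_bigr (fun i => \sum_j (i \in P j))%N) => [|i _]; last first.
    by rewrite -sum1_card big_mkcond /=; apply: eq_bigr => j _; rewrite inE; case: (i \in P j).
  rewrite exchange_big; apply: eq_bigr => j _.
  by rewrite -sum1_card [RHS]big_mkcond /=; apply: eq_bigr => i _; case: (i \in P j).
by apply: leq_trans (leq_sum _ (fun j _ => P_le j)) _; rewrite sum_nat_const card_ord.
Qed.

Lemma degree_le z : (#|[set z' | adjacency P high z z']%SET| <= K * t + t + 1)%N.
Proof.
(* The neighbours of a vertex lie in at most two layers, where they form the images of [A] and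
   [B]. *)
have two (A B : {set 'I_n}) (f g : 'I_n -> layered n) a b :
    (#|A| <= a)%N -> (#|B| <= b)%N -> (a + b <= K * t + t + 1)%N ->
    (forall z', adjacency P high z z' -> z' \in (f @: A) :|: (g @: B)) ->
    (#|[set z' | adjacency P high z z']%SET| <= K * t + t + 1)%N.
  move=> Aa Bb ab h; apply: leq_trans ab.
  apply: leq_trans (leq_add (leq_trans (leq_imset_card f A) Aa) (leq_trans (leq_imset_card g B) Bb)).
  apply: leq_trans (leq_card_setU _ _); apply: subset_leq_card.
  by apply/fintype.subsetP => z'; rewrite inE; exact: h.
pose v b c i : layered n := (b, c, i).
have readers_le i : i \notin high -> (#|readers i| <= K * t)%N by rewrite inE -leqNgt.
have low_le i : (#|if i \in high then finset.set0 else readers i| <= K * t)%N.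
  by case: ifPn => [_|/readers_le //]; rewrite cards0.
case: z two => [[[] []] i] two.
- apply: (two (P i) finset.set0 (v true false) (v true false) t 0%N) => //; rewrite ?cards0 //; first by lia.
  case=> [[[] []] j] //=; rewrite /adjacency /= ?orbF // => /andP[jP _].
  by rewrite inE; apply/orP; left; apply/imsetP; exists j.
- apply: (two (P i) (if i \in high then finset.set0 else readers i) (v false true) (v true true) t (K * t)%N) => //; first by lia.
  case=> [[[] []] j] //=; rewrite /adjacency /= ?orbF // => /andP[jP jH]; rewrite inE; apply/orP.
    by right; apply/imsetP; exists j => //; rewrite (negbTE jH) inE.
  by left; apply/imsetP; exists j.
- apply: (two [set i]%SET (if i \in high then finset.set0 else readers i) (v false false) (v true false) 1%N (K * t)%N) => //; rewrite ?cards1 //; first by lia.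
  case=> [[[] []] j] //=; rewrite /adjacency /= ?orbF //.
    move=> /andP[jP jH]; rewrite inE; apply/orP.
    by right; apply/imsetP; exists j => //; rewrite (negbTE jH) inE.
  by move=> /eqP->; rewrite inE; apply/orP; left; apply/imsetP; exists i; rewrite ?inE.
- apply: (two [set i]%SET finset.set0 (v false true) (v false true) 1%N 0%N) => //; rewrite ?cards1 ?cards0 //; first by lia.
  case=> [[[] []] j] //=; rewrite /adjacency /= ?orbF // => /eqP<-.
  by rewrite inE; apply/orP; left; apply/imsetP; exists i; rewrite ?inE.
Qed.
End HighDegree.

Section ChooseShift.
Variables (n' : nat) (V : finType) (adj : rel V) (s tt : 'I_n'.+1 -> V) (l M : nat).
Local Notation n := n'.+1.
Hypothesis s_inj : injective s.
Hypothesis ball_le : forall y, (#|nball adj l y| <= M)%N.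

(** Averaging over [d]: for fixed [i], symmetry of [rho] makes [d |-> rho d i] a bijection, so the
    near pairs for all shifts together number at most [n M]. *)
Lemma exists_far_shift : exists d, (n <= #|[set i | s i \notin nball adj l (tt (rho d i))]%SET| + M)%N.
Proof.
apply: contrapT => /forallNP h.
have near_gt d : (M < #|[set i | s i \in nball adj l (tt (rho d i))]%SET|)%N.
  rewrite ltnNge; apply/negP => hd; apply: (h d).
  rewrite -[X in (X <= _)%N]card_ord -(cardsC [set i | s i \in nball adj l (tt (rho d i))]%SET) addnC leq_add //.
  by apply: subset_leq_card; apply/fintype.subsetP => i; rewrite !inE.
have : (n * M < \sum_(d : 'I_n) #|[set i | s i \in nball adj l (tt (rho d i))]%SET|)%N.
  apply: (@leq_trans (\sum_(d : 'I_n) M.+1)%N); last by apply: leq_sum => d _; exact: near_gt.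
  by rewrite sum_nat_const card_ord ltn_pmul2l.
rewrite ltnNge => /negP; apply.
have -> : (\sum_(d : 'I_n) #|[set i | s i \in nball adj l (tt (rho d i))]%SET| =
    \sum_k \sum_i (s i \in nball adj l (tt k)))%N.
  rewrite (eq_bigr (fun d => \sum_i (s i \in nball adj l (tt (rho d i))))%N) => [|d _]; last first.
    by rewrite -sum1_card big_mkcond /=; apply: eq_bigr => i _; rewrite inE; case: (_ \in _).
  rewrite exchange_big [RHS]exchange_big /=; apply: eq_bigr => i _.
  rewrite [RHS](reindex_inj (inv_inj (rhoK i))); apply: eq_bigr => d _.
  by rewrite rhoC.
apply: (@leq_trans (\sum_(k : 'I_n) M)%N); last by rewrite sum_nat_const card_ord.
apply: leq_sum => k _; apply: leq_trans (ball_le (tt k)).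
apply: (@leq_trans #|s @: [set i | s i \in nball adj l (tt k)]%SET|).
  rewrite card_imset // -sum1_card [leqRHS]big_mkcond /=.
  by apply: leq_sum => i _; rewrite inE; case: (_ \in _).
by apply: subset_leq_card; apply/fintype.subsetP => y /imsetP[i]; rewrite inE => iB ->.
Qed.
End ChooseShift.

(** * The trade-off for the Fourier transform *)

Section Fibre.
Variables (F : finFieldType) (n' s : nat) (om : F).
Local Notation n := n'.+1.
Local Notation q := #|F|.
Variables (adv : n.-tuple F -> s.-tuple bool) (P : 'I_n -> {set 'I_n}) (H : {set 'I_n}).
Hypothesis prim : n.-primitive_root om.
Hypothesis det : forall v v' j, adv v = adv v' ->
  (forall i, i \in P j -> tnth v i = tnth v' i) -> dft om v j = dft om v' j.

(** Pigeonhole on the advice for [v] and for [twist d v], together with the entries of [v] and of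
    its transform at [H]. On one fibre, all that a query sees outside the unfixed probes is
    constant. *)
Lemma exists_fibre (d : 'I_n) : exists X : {set n.-tuple F},
  [/\ (q ^ n <= 2 ^ (2 * s) * q ^ (2 * #|H|) * #|X|)%N,
      forall y y' j, y \in X -> y' \in X ->
        (forall i, i \in P j -> i \notin H -> tnth y i = tnth y' i) -> dft om y j = dft om y' j &
      forall y y' l, y \in X -> y' \in X ->
        (forall j, j \in P l -> j \notin H -> dft om y j = dft om y' j) ->
        tnth y (rho d l) = tnth y' (rho d l)].
Proof.
pose HT : finType := {i : 'I_n | i \in H}.
pose key (v : n.-tuple F) := (adv v, adv (twist om d v),
  [ffun i : HT => tnth v (val i)], [ffun i : HT => dft om v (val i)]).
have q0 : (0 < q)%N by apply/card_gt0P; exists 0.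
have [|b bP] := large_fibre key; first by rewrite card_tuple expn_gt0 q0.
exists [set v | key v == b]%SET.
have keyP y y' : y \in [set v | key v == b]%SET -> y' \in [set v | key v == b]%SET -> key y = key y'.
  by rewrite !inE => /eqP-> /eqP->.
split.
- move: bP; rewrite !card_prod !card_ffun !card_tuple card_sig card_bool.
  by rewrite !mul2n -!addnn !expnD !mulnA.
- move=> y y' j /keyP h /h[ea _ eH _] agree; apply: det => // i iP.
  have [iH|iH] := boolP (i \in H); last exact: agree.
  by have := congr1 (fun f : {ffun HT -> F} => f (exist _ i iH)) eH; rewrite !ffunE.
- move=> y y' l /keyP h /h[_ ea _ eH] agree.
  (* The second run of the structure has input [twist d y]; its output at [l] is [n] times the
     wanted coordinate, and [n] is invertible in [F]. *)
  apply: (mulfI (prim_root_natf_neq0 prim)); rewrite -!(dft_twist prim); apply: det => // j jP.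
  rewrite !tnth_mktuple; congr (_ * _).
  have [jH|jH] := boolP (j \in H); last exact: agree.
  by have := congr1 (fun f : {ffun HT -> F} => f (exist _ j jH)) eH; rewrite !ffunE.
Qed.
End Fibre.

Section Core.
Variables (R : realType) (NCC : weaker_NCC R).
Variables (F : finFieldType) (n' s t K e : nat) (om : F) (eps : R).
Local Notation n := n'.+1.
Local Notation q := #|F|.
Local Notation lq := (@log2 R q%:R).
Variables (adv : n.-tuple F -> s.-tuple bool) (P : 'I_n -> {set 'I_n}).
Hypothesis prim : n.-primitive_root om.
Hypothesis det : forall v v' j, adv v = adv v' ->
  (forall i, i \in P j -> tnth v i = tnth v' i) -> dft om v j = dft om v' j.
Hypothesis P_le : forall j, (#|P j| <= t)%N.
Hypothesis t_gt0 : (0 < t)%N.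
Hypothesis K_gt0 : (0 < K)%N.
Hypothesis s_le : s%:R <= eps * n%:R * lq.
Hypothesis epsK : 2 * eps + 2 / K%:R <= 512^-1.
Hypothesis lq_ge : 8 * e%:R <= lq.
Hypothesis lq_le : lq <= 8 * (e%:R + 1).
Hypothesis e_ge : (256 <= e)%N.

Lemma eR_ge : 256 <= e%:R :> R. Proof. by rewrite ler_nat. Qed.

Local Notation H := (high t K P).

(** The deficit is at most [2 s + 2 #|H| lq <= n lq / 512], and [lq <= 16 e]. *)
Lemma log2_density (X : {set n.-tuple F}) :
  (q ^ n <= 2 ^ (2 * s) * q ^ (2 * #|H|) * #|X|)%N ->
  (0 < #|X|)%N /\ log2 ((q ^ n)%:R / #|X|%:R) / e%:R <= n%:R / 32 :> R.
Proof.
have := (eR_ge, lq_ge, lq_le, epsK) => -[[[eR lqg] lql] eK]; move=> Xl; have q0 : (0 < q)%N by apply/card_gt0P; exists 0.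
have X0 : (0 < #|X|)%N.
  have : (0 < q ^ n)%N by rewrite expn_gt0 q0.
  by move=> /leq_trans/(_ Xl); rewrite muln_gt0 => /andP[].
split=> //.
have qR : 0 < q%:R :> R by rewrite ltr0n.
have e0 : 0 < e%:R :> R by lra.
have h : log2 ((q ^ n)%:R / #|X|%:R) <= 2 * s%:R + 2 * #|H|%:R * lq :> R.
  have -> : 2 * s%:R = log2 (2 ^ (2 * s))%:R :> R by rewrite natrX log2X // log2_2 mulr1 natrM.
  have -> : 2 * #|H|%:R * lq = log2 (q ^ (2 * #|H|))%:R by rewrite natrX log2X // natrM.
  rewrite -log2M ?ltr0n ?expn_gt0 ?q0 //.
  apply: ler_log2; first by rewrite divr_gt0 ?ltr0n ?expn_gt0 ?q0.
  by rewrite ler_pdivrMr ?ltr0n // -!natrM ler_nat.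
have hK : #|H|%:R <= n%:R / K%:R :> R.
  by rewrite ler_pdivlMr ?ltr0n // -natrM ler_nat mulnC card_high.
have lq0 : 0 <= lq :> R by lra.
have n0 : 0 <= n%:R :> R by [].
have h2 : log2 ((q ^ n)%:R / #|X|%:R) <= n%:R * lq * 512^-1 :> R.
  apply: le_trans h _; apply: (@le_trans _ _ (n%:R * lq * (2 * eps + 2 / K%:R))).
    have := ler_wpM2r lq0 hK; have := s_le.
    set z := n%:R / K%:R; have -> : n%:R * lq * (2 * eps + 2 / K%:R) =
      2 * (eps * n%:R * lq) + 2 * (z * lq) by rewrite /z; ring.
    by set y := #|H|%:R * lq; have -> : 2 * #|H|%:R * lq = 2 * y; [rewrite /y; ring|lra].
  by apply: ler_wpM2l => //; exact: mulr_ge0.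
rewrite ler_pdivrMr //; apply: le_trans h2 _.
have : n%:R * lq <= n%:R * (16 * e%:R) by apply: ler_wpM2l => //; lra.
lra.
Qed.

(** Per coordinate, [1 + log2 k = e + 8 <= (1/8 + 1/256) lq], and misses add at most
    [(1/32 + 1/256 + 1/64) lq] on average; in total [46/256 < 3/16]. *)
Lemma sum_correction_cap (X : {set n.-tuple F}) (B : n.-tuple {ffun 'I_(2 * 2 ^ e * 64) -> F}) x :
  \sum_(i < n) \sum_w miss R (tnth B i) (tnth (x w) i - tnth w i)
      <= (q ^ n)%:R * (log2 ((q ^ n)%:R / #|X|%:R) / e%:R + n%:R * (e%:R^-1 + 64^-1)) ->
  log2 ((q ^ n)%:R / #|X|%:R) / e%:R <= n%:R / 32 :> R ->
  \sum_i correction_cap R B x i <= n%:R * lq * (3 / 16).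
Proof.
have := (eR_ge, lq_ge, lq_le, epsK) => -[[[eR lqg] lql] eK]; move=> hB hX; have q0 : (0 < q)%N by apply/card_gt0P; exists 0.
have qn0 : 0 < (q ^ n)%:R :> R by rewrite ltr0n expn_gt0 q0.
have lq0 : 0 <= lq by lra.
have e0 : 0 < e%:R :> R by lra.
have n0 : 0 <= n%:R :> R by [].
rewrite /correction_cap big_split /= sumr_const card_ord -mulr_suml -mulr_suml.
have -> : log2 (2 * 2 ^ e * 64)%:R = e%:R + 7 :> R.
  have -> : (2 * 2 ^ e * 64 = 2 ^ (e + 7))%N by rewrite expnD mulnAC mulnC.
  by rewrite natrX log2X // log2_2 mulr1 natrD.
have hp : (\sum_(i < n) \sum_w miss R (tnth B i) (tnth (x w) i - tnth w i)) / (q ^ n)%:R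
    <= n%:R * (32^-1 + (e%:R^-1 + 64^-1)).
  by rewrite ler_pdivrMr // mulrC; apply: le_trans hB _; rewrite ler_pM2l //; lra.
have ei : e%:R^-1 <= 256^-1 :> R by rewrite lef_pV2 ?posrE.
have hp2 := ler_wpM2r lq0 hp; rewrite -[X in X + _ <= _]mulr_natl.
have h1 : n%:R * (1 + (e%:R + 7)) <= n%:R * (lq * (8^-1 + 256^-1)) by apply: ler_wpM2l => //; lra.
have h2 : n%:R * (32^-1 + (e%:R^-1 + 64^-1)) * lq <= n%:R * lq * (32^-1 + 256^-1 + 64^-1).
  rewrite mulrAC; apply: ler_wpM2l; [exact: mulr_ge0|lra].
have h3 : n%:R * lq * (8^-1 + 256^-1 + (32^-1 + 256^-1 + 64^-1)) <= n%:R * lq * (3 / 16).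
  by apply: ler_wpM2l; [exact: mulr_ge0|lra].
lra.
Qed.

(** Otherwise balls of radius [l] have at most [n / 4] vertices, so some shift makes three quarters
    of the pairs far. The code has rate [lq], but the flow rate is at most [C / A < lq]. *)
Lemma probes_lower_bound : (n < 4 * ((K + 3) * t) ^ (49 * t))%N.
Proof.
have := (eR_ge, lq_ge, lq_le, epsK) => -[[[eR lqg] lql] eK]; rewrite ltnNge; apply/negP => n_ge.
(* The final comparison is [1 + 2 t + (11/16) l < (3/4) l], that is [l > 32 t + 16]. *)
pose l := (32 * t + 17)%N.
have lt : (l <= 49 * t)%N by rewrite /l; lia.
have l0 : 0 < l%:R :> R by rewrite ltr0n /l addn_gt0 orbT.
have n0 : 0 < n%:R :> R by rewrite ltr0n.
have q1 : (1 < q)%N.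
  by apply/card_gt1P; exists 0, 1; split => //; rewrite eq_sym oner_neq0.
have e0 : (0 < e)%N by rewrite -(ltr_nat R); lra.
have ball_le y : (#|nball (adjacency P H) l y| <= ((K + 3) * t) ^ (49 * t))%N.
  apply: leq_trans (card_ball_le (D := K * t + t + 1) _ _ _) _; first exact: degree_le.
  apply: (@leq_trans (((K + 3) * t) ^ l)%N); last by rewrite leq_pexp2l // muln_gt0 t_gt0 addn_gt0 K_gt0.
  by rewrite leq_exp2r; [lia|rewrite /l; lia].
have s_inj : injective (fun i : 'I_n => (false, false, i) : layered n) by move=> i j [].
have [d dP] := exists_far_shift (fun k => (true, true, k)) s_inj ball_le.
set far := [set i | _]%SET in dP.
have [X [X_large Phi_det inv_det]] := exists_fibre H prim det d.
have [X0 hX] := log2_density X_large.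
have [B [x [x_in hB]]] := covering_pool R e0 X0.
have k0 : (0 < 2 * 2 ^ e * 64)%N by rewrite !muln_gt0 expn_gt0.
have hcu := sum_correction_cap hB hX.
have coding := ds_coding_achieves R B (rhoK d) k0 q1 x_in Phi_det inv_det.
set N := ds_network _ _ _ _ _ in coding.
have lq0 : 0 < lq by lra.
pose C : R := n%:R * lq * (1 + 2 * t%:R) + l%:R / 2 * (n%:R * lq + 2 * \sum_i correction_cap R B x i).
pose A : R := #|far|%:R * l%:R.
have far_ge : 3 / 4 * n%:R <= #|far|%:R :> R.
  have : n%:R <= #|far|%:R + (((K + 3) * t) ^ (49 * t))%:R :> R by rewrite -natrD ler_nat.
  have : 4 * (((K + 3) * t) ^ (49 * t))%:R <= n%:R :> R by rewrite -natrM ler_nat.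
  lra.
have A0 : 0 < A.
  by rewrite mulr_gt0 // (lt_le_trans _ far_ge) // mulr_gt0.
have rate_le : (flow_rate (un N) <= (C / A)%:E)%E.
  apply: ge_ereal_sup => _ [r fr <-]; rewrite lee_fin ler_pdivlMr //.
  (* For negative [r] it is enough that [C] is nonnegative. *)
  have [r0|r0] := leP 0 r; last first.
    apply: (@le_trans _ _ 0); first by rewrite mulr_le0_ge0 // ltW.
    have sc0 : 0 <= \sum_i correction_cap R B x i.
      by apply: sumr_ge0 => i _; apply: ltW; exact: correction_cap_gt0.
    have nlq0 : 0 <= n%:R * lq by apply: mulr_ge0 => //; exact: ltW.
    apply: addr_ge0; first by apply: mulr_ge0 => //; apply: addr_ge0 => //; exact: mulr_ge0.
    apply: mulr_ge0; first exact: divr_ge0.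
    by apply: addr_ge0 => //; exact: mulr_ge0.
  apply: (flow_bound (rhoK d) P_le r0 fr) => i.
  by rewrite inE.
have coding_le : (lq%:E <= coding_rate N)%E by apply: ereal_sup_ubound; exists lq.
have := le_trans coding_le (le_trans (NCC N) rate_le).
rewrite lee_fin ler_pdivlMr // leNgt => /negP; apply.
have lE : l%:R = 32 * t%:R + 17 :> R by rewrite /l natrD natrM.
have nlq : 0 < n%:R * lq by exact: mulr_gt0.
have c1 : C <= n%:R * lq * (1 + 2 * t%:R + l%:R / 2 * (1 + 3 / 8)).
  rewrite /C [leRHS]mulrDr lerD2l [leRHS]mulrCA; apply: ler_wpM2l; first exact: divr_ge0.
  by move: hcu; lra.
apply: le_lt_trans c1 _.
apply: (@lt_le_trans _ _ (lq * (3 / 4 * n%:R * l%:R))); last first.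
  by rewrite /A; apply: ler_wpM2l; [exact: ltW|apply: ler_wpM2r; [exact: ltW|]].
have -> : lq * (3 / 4 * n%:R * l%:R) = n%:R * lq * (3 / 4 * l%:R) by ring.
rewrite ltr_pM2l // lE; lra.
Qed.
End Core.

(** * Primitive roots and the asymptotic form of the bound *)

Lemma exists_prim_root (F : finFieldType) n : (0 < n)%N -> (n %| #|F|.-1)%N ->
  exists om : F, n.-primitive_root om.
Proof.
move=> n0 nq.
have q1 : (1 < #|F|)%N by apply/card_gt1P; exists 0, 1; split=> //; rewrite eq_sym oner_neq0.
have : has #|F|.-1.-primitive_root (enum (predC1 (0 : F))).
  apply: cyclic.has_prim_root; rewrite ?enum_uniq -?cardE ?cardC1 //; first by lia.
  apply/allP => x; rewrite mem_enum inE => x0; rewrite unity_rootE.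
  by rewrite -(inj_eq (mulfI x0)) -exprS prednK ?mulr1 ?finfield.expf_card // ltnW.
by move=> /hasP[z _ zP]; exists (z ^+ (#|F|.-1 %/ n)); exact: dvdn_prim_root.
Qed.

(** Here [e] is an eighth of [trunc_log 2 q], rounded down, so that [2^e] is about [q^(1/8)] and a
    correction from a pool costs about an eighth of a field element. *)
Lemma log2_bracket (R : realType) q : 4096%:R <= log2 q%:R :> R ->
  exists e, [/\ (256 <= e)%N, 8 * e%:R <= log2 q%:R :> R & log2 q%:R <= 8 * (e%:R + 1) :> R].
Proof.
case: q => [|q]; first by rewrite /log2 ln0 // mul0r lern0.
set l := log2 _ => lge; pose u := trunc_log 2 q.+1.
have /andP[] := @trunc_log_bounds 2 q.+1 isT isT; rewrite -/u => lo hi.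
have ul : u%:R <= l.
  have : log2 (2 ^ u)%:R <= l by apply: ler_log2; rewrite ?ltr0n ?expn_gt0 // ler_nat.
  by rewrite natrX log2X // log2_2 mulr1.
have lu : l <= u%:R + 1.
  have : l <= log2 (2 ^ u.+1)%:R by apply: ler_log2; rewrite ?ltr0n // ler_nat ltnW.
  by rewrite natrX log2X // log2_2 mulr1 -natr1.
have ue : u = (8 * (u %/ 8) + u %% 8)%N by rewrite mulnC -divn_eq.
have ur : (u %% 8).+1%:R <= 8 :> R by rewrite ler_nat ltn_mod.
have ur0 : 0 <= (u %% 8)%:R :> R by [].
move: (u %/ 8)%N (u %% 8)%N ue ur ur0 => e r ue; rewrite -natr1 => ur ur0.
have uR : u%:R = 8 * e%:R + r%:R :> R by rewrite ue natrD natrM.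
exists e; split; [|lra|lra].
rewrite -(ler_nat R); move: lge; have -> : 4096%:R = 16 * 256%:R :> R by rewrite -natrM.
have : 1 <= 256%:R :> R by rewrite ler1n.
move: (256%:R : R) => z z1 lz.
lra.
Qed.

Lemma log2_probes (R : realType) m n t : (m <= 2 ^ 12)%N -> (0 < n)%N -> (0 < t)%N ->
  (n < 4 * (m * t) ^ (49 * t))%N ->
  log2 n%:R <= 2 + 49 * t%:R * (12 + log2 t%:R) :> R.
Proof.
move=> m12 n0 t0 nlt; have tR : 0 < t%:R :> R by rewrite ltr0n.
have k0 : 0 < 2 ^+ 12 * t%:R :> R by rewrite mulr_gt0 // exprn_gt0.
have -> : 2 + 49 * t%:R * (12 + log2 t%:R) = log2 (2 ^+ 2 * (2 ^+ 12 * t%:R) ^+ (49 * t)) :> R.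
  rewrite log2M ?exprn_gt0 // !log2X // log2M ?exprn_gt0 // log2X // log2_2 !mulr1.
  by rewrite natrM.
apply: ler_log2; first by rewrite ltr0n.
apply: (@le_trans _ _ (4 * (m * t) ^ (49 * t))%N%:R); first by rewrite ler_nat ltnW.
have -> : (4 * (m * t) ^ (49 * t))%N%:R = 2 ^+ 2 * (m%:R * t%:R) ^+ (49 * t) :> R.
  have -> : 2 ^+ 2 = 4 :> R by ring.
  by rewrite natrM natrX natrM.
apply: ler_wpM2l; first exact: exprn_ge0.
have le12 : m%:R * t%:R <= 2 ^+ 12 * t%:R :> R.
  have -> : 2 ^+ 12 = (2 ^ 12)%N%:R :> R by rewrite natrX.
  by rewrite ler_pM2r // ler_nat.
have : 0 <= m%:R * t%:R :> R by rewrite mulr_ge0 ?ler0n.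
move: (m%:R * t%:R) (2 ^+ 12 * t%:R) le12 => a b ab a0.
by apply: lerXn2r; rewrite ?nnegrE // (le_trans a0).
Qed.

(** If [t l < L / 196], then [12 + log2 t <= 2 l] turns [log2_probes] into [L <= 2 + L / 2], against
    [L >= 5]; thus 196 is [4 * 49]. *)
Lemma probes_asymptotic (R : realType) m n t : 4096%:R <= log2 n%:R :> R ->
  (m <= 2 ^ 12)%N -> (0 < n)%N -> (0 < t)%N -> (n < 4 * (m * t) ^ (49 * t))%N ->
  196^-1 * (log2 n%:R / log2 (log2 n%:R)) <= t%:R :> R.
Proof.
move=> L_ge m12 n0 t0 nlt; have := log2_probes R m12 n0 t0 nlt; move: L_ge.
set L := log2 n%:R => L_ge Lt; set l := log2 L.
have L0 : 0 < L by apply: lt_le_trans L_ge; rewrite ltr0n.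
have l12 : 12 <= l.
  have -> : 12 = log2 (2 ^+ 12) :> R by rewrite log2X // log2_2 mulr1.
  apply: ler_log2; first by rewrite exprn_gt0.
  have -> : 2 ^+ 12 = (2 ^ 12)%N%:R :> R by rewrite natrX.
  by apply: le_trans L_ge; rewrite ler_nat.
have tR : 0 < t%:R :> R by rewrite ltr0n.
have L5 : 5 <= L by apply: le_trans L_ge; rewrite ler_nat.
clear L_ge nlt; rewrite mulrA ler_pdivrMr; last by lra.
rewrite leNgt; apply/negP => h.
have tL : t%:R <= L.
  have : t%:R * 1 <= t%:R * l by rewrite ler_pM2l //; lra.
  lra.
have lt : log2 t%:R <= l by apply: ler_log2.
have : t%:R * (12 + log2 t%:R) <= t%:R * (l + l) by rewrite ler_pM2l //; lra.
lra.
Qed.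

Section Bound.
Variables (R : realType) (NCC : weaker_NCC R) (F : finFieldType) (n' s t : nat) (om : F) (eps : R).
Local Notation n := n'.+1.
Local Notation q := #|F|.
Variables (adv : n.-tuple F -> s.-tuple bool) (P : 'I_n -> {set 'I_n}).
Hypothesis prim : n.-primitive_root om.
Hypothesis det : forall v v' j, adv v = adv v' ->
  (forall i, i \in P j -> tnth v i = tnth v' i) -> dft om v j = dft om v' j.
Hypothesis P_le : forall j, (#|P j| <= t)%N.
Hypothesis eps_le : eps <= 2048%:R^-1.
Hypothesis s_le : s%:R <= eps * n%:R * log2 q%:R.
Hypothesis nq : (n <= q)%N.
Hypothesis n_large : 4096%:R <= log2 n%:R :> R.

Lemma dft_probes_ge : 196^-1 * (log2 n%:R / log2 (log2 n%:R)) <= t%:R :> R.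
Proof.
have lq_ge : 4096%:R <= log2 q%:R :> R.
  by apply: le_trans n_large _; apply: ler_log2; rewrite ?ltr0n ?ler_nat.
have [e [e_ge lo hi]] := log2_bracket lq_ge.
(* The choice [K = 2048] balances the two terms: [4 / 2048 = 1 / 512]. *)
have epsK : 2 * eps + 2 / 2048%:R <= 512^-1.
  have -> : 512 = 2048%:R / 4 :> R by rewrite (_ : 2048 = 512 * 4)%N // natrM mulfK.
  by rewrite invf_div; have := eps_le; lra.
have K12 : (2048 + 3 <= 2 ^ 12)%N by [].
have lower t' : (forall j, (#|P j| <= t')%N) -> (0 < t')%N ->
    (n < 4 * ((2048 + 3) * t') ^ (49 * t'))%N.
  move=> Pt t0; exact: (@probes_lower_bound _ NCC _ _ _ _ 2048 _ _ _ _ _ prim det Pt t0 _ s_le epsK lo hi e_ge).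
have bound t' : (forall j, (#|P j| <= t')%N) -> (0 < t')%N ->
    196^-1 * (log2 n%:R / log2 (log2 n%:R)) <= t'%:R :> R.
  move=> Pt t0; by apply: (probes_asymptotic n_large K12) => //; exact: lower.
(* A structure without probes also satisfies the bound with one probe, which would give
   [log2 n <= 2 + 49 * 12 = 590]. *)
have [t0|t0] := posnP t; last exact: bound.
have := log2_probes R K12 (ltn0Sn n') (ltn0Sn 0) (lower 1%N (fun j => leq_trans (P_le j) _) isT).
rewrite t0 => /(_ isT) h; have := le_trans n_large h; rewrite log21 addr0 mulr1 -natrM -natrD.
by rewrite ler_nat.
Qed.
End Bound.

(** * Evaluation and interpolation *)

(** The query algorithm sees only the advice and the probed entries. The trade-off uses a structure
    through this determinacy and the sizes of its advice and probe sets. *)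
Lemma answer_det n (X Q A : Type) (spec : ('I_n -> X) -> Q -> A -> Prop) s t
    (ds : nonadaptive_ds spec s t) I I' qu a a' :
  spec I qu a -> spec I' qu a' -> advice ds I = advice ds I' ->
  (forall i, i \in probe ds qu -> I i = I' i) -> a = a'.
Proof.
move=> /(answer_correct ds) <- /(answer_correct ds) <- -> II'; congr (answer _ _).
by apply: functional_extensionality_dep => i; apply: funext => iP; exact: II'.
Qed.

Section Unpack.
Variables (F : finFieldType) (n' s t : nat) (om : F).
Local Notation n := n'.+1.
Hypothesis prim : n.-primitive_root om.

Lemma eval_dft (v : n.-tuple F) (j : 'I_n) : eval_spec (tnth v) (om ^+ j) (dft om v j).
Proof.
rewrite /eval_spec horner_sum; apply: eq_bigr => i _.
by rewrite hornerZ hornerXn -exprM mulnC.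
Qed.

Lemma eval_ds_det (ds : nonadaptive_ds (@eval_spec F n) s t) (v v' : n.-tuple F) (j : 'I_n) :
  advice ds (tnth v) = advice ds (tnth v') ->
  (forall i, i \in probe ds (om ^+ j) -> tnth v i = tnth v' i) -> dft om v j = dft om v' j.
Proof. by apply: answer_det; exact: eval_dft. Qed.

(** The point is [om^-i], written with a natural exponent. *)
Definition samples (v : n.-tuple F) (i : 'I_n) : F * F := (om ^+ (n - i), tnth v i).

(** Fourier inversion: the polynomial with coefficients [dft v / n] takes the value [v_i] at
    [om^-i]. *)
Lemma interp_dft (v : n.-tuple F) (j : 'I_n) :
  interp_spec (samples v) j (n%:R^-1 * dft om v j).
Proof.
split=> [i i' /= /eqP|].
  rewrite (eq_prim_root_expr prim) => /eqP h; apply: ord_inj.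
  have : (om ^+ i == om ^+ i').
    have nz k : om ^+ k != 0 by rewrite expf_neq0 // (prim_root_eq0 prim).
    have e (k : 'I_n) : om ^+ k * om ^+ (n - k) = 1.
      by rewrite -exprD subnKC ?(prim_expr_order prim) // ltnW.
    rewrite -(inj_eq (mulIf (nz (n - i)%N))) e -(e i') eq_sym.
    by rewrite (inj_eq (mulfI (nz i'))) (eq_prim_root_expr prim) h.
  by rewrite (eq_prim_root_expr prim) !modn_small // => /eqP.
exists (\poly_(k < n) (n%:R^-1 * dft om v (inord k))); split.
- exact: size_poly.
- move=> i /=; rewrite horner_poly.
  rewrite (eq_bigr (fun k : 'I_n => n%:R^-1 * \sum_(m < n) tnth v m * (om ^+ (m + (n - i))) ^+ k)).
    rewrite -mulr_sumr exchange_big /= (bigD1 i) //= [X in _ + X]big1 => [|m mi].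
      rewrite addr0 -mulr_sumr (sum_prim_root prim) subnKC ?dvdnn; last exact: ltnW.
      by rewrite mulrC mulfK // (prim_root_natf_neq0 prim).
    rewrite -mulr_sumr (sum_prim_root prim) ifF ?mulr0 //; apply/negbTE; apply: contra mi => nd.
    apply/eqP/ord_inj.
    (* Since [0 < m + (n - i) < 2 n], the quotient is 1 and [m = i]. *)
    have := ltn_ord m; have := ltn_ord i; move/dvdnP: nd => [[|[|c]] h]; nia.
  move=> k _; rewrite -mulrA; congr (_ * _); rewrite mulr_suml; apply: eq_bigr => m _.
  by rewrite inord_val -mulrA -!exprM -exprD mulnDl.
- by rewrite coef_poly ltn_ord inord_val.
Qed.

(** The sample points are the same for all [v], so a probe reveals a single entry of [v]. *)
Lemma interp_ds_det (ds : nonadaptive_ds (@interp_spec F n) s t) (v v' : n.-tuple F) (j : 'I_n) :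
  advice ds (samples v) = advice ds (samples v') ->
  (forall i, i \in probe ds j -> tnth v i = tnth v' i) -> dft om v j = dft om v' j.
Proof.
move=> ea ep; have n0 : n%:R^-1 != 0 :> F by rewrite invr_eq0 (prim_root_natf_neq0 prim).
apply: (mulfI n0); apply: (answer_det (interp_dft v j) (interp_dft v' j) ea) => i /ep.
by rewrite /samples => ->.
Qed.
End Unpack.

Theorem theorem3 (R : realType) (NCC : weaker_NCC R) :
  exists2 eps0 : R, 0 < eps0 &
  forall eps : R, 0 < eps -> eps <= eps0 ->
  exists2 c : R, 0 < c &
  exists n0 : nat, forall (F : finFieldType) (n : nat),
    (n %| #|F|.-1)%N -> (n0 <= n)%N ->
    ((c * (log2 n%:R / log2 (log2 n%:R)))%:E
       <= t_Eval F n (eps * n%:R * log2 #|F|%:R))%E /\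
    ((c * (log2 n%:R / log2 (log2 n%:R)))%:E
       <= t_Interp F n (eps * n%:R * log2 #|F|%:R))%E.
Proof.
exists 2048%:R^-1; first by rewrite invr_gt0 ltr0n.
move=> eps _ eps_le; exists 196^-1; first by rewrite invr_gt0.
have [n0 n0P] : exists n0, forall n, (n0 <= n)%N -> (0 < n)%N /\ 4096%:R <= log2 n%:R :> R.
  (* The threshold is [2^4096], kept symbolic. *)
  move: 4096%N => m; exists (2 ^ m)%N => n mn.
  have n0 : (0 < n)%N by apply: leq_trans mn; rewrite expn_gt0.
  split=> //; have <- : log2 (2 ^ m)%:R = m%:R :> R by rewrite natrX log2X // log2_2 mulr1.
  by apply: ler_log2; rewrite ?ltr0n ?expn_gt0 // ler_nat.
exists n0 => F n nq /n0P[]; case: n nq => // n' nq _ n_large.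
have [om prim] := exists_prim_root (ltn0Sn n') nq.
have q1 : (1 < #|F|)%N by apply/card_gt1P; exists 0, 1; split=> //; rewrite eq_sym oner_neq0.
have n_le : (n'.+1 <= #|F|)%N.
  by apply: leq_trans (dvdn_leq _ nq) (leq_pred _); rewrite -subn1 subn_gt0.
split; apply/ereal_infP => _ [t [s s_le [ds]] <-]; rewrite lee_fin.
- apply: (dft_probes_ge NCC prim (adv := fun v => advice ds (tnth v))
    (P := fun j => probe ds (om ^+ j)) _ _ eps_le s_le n_le n_large); last by move=> j; exact: probe_le.
  by move=> v v' j; exact: eval_ds_det.
- apply: (dft_probes_ge NCC prim (adv := fun v => advice ds (samples om v))
    (P := probe ds) _ _ eps_le s_le n_le n_large); last by move=> j; exact: probe_le.
  by move=> v v' j; exact: interp_ds_det.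
Qed.
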